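(* The swirl of an axisymmetric velocity field is transported by its flow. More precisely, if $u_0\in T_e\mathscr{A}^s_\mu$, $u(t)$ is the solution of the Euler equations with $u(0)=u_0$, and $\gamma(t)$ is the corresponding $L^2$ geodesic in $\mathscr{A}^s_\mu$, then $$\sigma_{u(t)}\circ\gamma(t)=\sigma_{u_0}$$ for as long as it is defined.
   Context: $M$ is a connected oriented Riemannian 3-manifold, compact (possibly with boundary) or $\mathbb{R}^3$; $\mu$ is its Riemannian volume; $K$ is a smooth Killing field on $M$ (tangent to $\partial M$) with flow $\varphi_t$; $s>5/2$. $T_e\mathscr{A}^s_\mu$ is the space of axisymmetric fields: divergence-free Sobolev $H^s$ vector fields $u$ on $M$, tangent to $\partial M$, with $[K,u]=0$. $\mathscr{A}^s_\mu$ is the group of $H^s$ volume-preserving diffeomorphisms of $M$ commuting with $\varphi_t$ for all $t$. The swirl of an axisymmetric field $v$ is the function $\sigma_v=\langle v,K\rangle$. The Euler equations are $\partial_tu+\nabla_uu=-\nabla p$, $\operatorname{div}u=0$, $u(0)=u_0$, with $u$ tangent to $\partial M$. The corresponding geodesic of the right-invariant $L^2$ metric $\int_M\langle v,w\rangle d\mu$ is the flow $\gamma(t)$ of $u$: $\frac{d\gamma}{dt}(t,x)=u(t,\gamma(t,x))$, $\gamma(0,x)=x$. *)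

(* Defs.v *)
From HB Require Import structures.
From mathcomp Require Import all_boot all_order all_algebra.
From mathcomp Require Import all_classical all_reals all_analysis.

Set Implicit Arguments.
Unset Strict Implicit.
Unset Printing Implicit Defensive.

Import Order.TTheory GRing.Theory Num.Theory numFieldNormedType.Exports.
Local Open Scope classical_set_scope.
Local Open Scope ring_scope.

(** * Directional derivatives relative to a set

    The difference quotient is taken only over the [h] for which [x + h v]
    stays in [A]: a two-sided derivative where [A] contains a segment around
    [x], and a one-sided one at the boundary of a half-space or at an end point
    of a time interval. *)

Section DerivativeWithin.
Context {R : realType} {V W : normedModType R}.
Implicit Types (A : set V) (f : V -> W) (x v : V).

Definition quotient_within A f x v : set_system W :=
  (h^-1 *: (f (h *: v + x) - f x))
    @[h --> within [set h : R | A (h *: v + x)] 0^'].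

Definition derivable_within A f x v : Prop := cvg (quotient_within A f x v).

Definition derive_within A f x v : W := lim (quotient_within A f x v).

End DerivativeWithin.

(** * Fractional Sobolev spaces on an open subset of R^3 *)

Section Sobolev.
Variable R : realType.
Implicit Types (Omega : set 'rV[R]_3) (f phi : 'rV[R]_3 -> R).

Definition basis_vec (j : 'I_3) : 'rV[R]_3 := delta_mx 0 j.

Definition vec3 (z : R * R * R) : 'rV[R]_3 :=
  \row_(k < 3) nth 0 [:: z.1.1; z.1.2; z.2] k.

Definition lebesgue3 :=
  ((@lebesgue_measure R \x @lebesgue_measure R) \x @lebesgue_measure R)%E.

Definition integral3 Omega (f : 'rV[R]_3 -> \bar R) : \bar R :=
  (\int[lebesgue3]_(z in vec3 @^-1` Omega) f (vec3 z))%E.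

Definition square_integrable Omega f : Prop :=
  measurable_fun (vec3 @^-1` Omega) (f \o vec3)
  /\ (integral3 Omega (fun x => (f x ^+ 2)%:E) < +oo)%E.

(** A multi-index is given as the list of the directions of differentiation. *)
Definition partials (l : seq 'I_3) f : 'rV[R]_3 -> R :=
  foldr (fun j h x => 'D_(basis_vec j) h x) f l.

Definition test_function Omega phi : Prop :=
  [/\ forall l, continuous (partials l phi),
      forall l j x, derivable (partials l phi) x (basis_vec j)
    & exists C : set 'rV[R]_3,
        [/\ compact C, C `<=` Omega & forall x, ~ C x -> phi x = 0]].

Definition weak_partial Omega (l : seq 'I_3) f g : Prop :=
  forall phi, test_function Omega phi ->
    integral3 Omega (fun x => (f x * partials l phi x)%:E)
    = (((-1) ^+ size l)%:E
        * integral3 Omega (fun x => (g x * phi x)%:E))%E.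

Definition norm2 (x : 'rV[R]_3) : R := \sum_(k < 3) x 0 k ^+ 2.

(** Square of the Gagliardo seminorm of exponent [theta]. *)
Definition gagliardo Omega (theta : R) f : \bar R :=
  integral3 Omega (fun x => integral3 Omega (fun y =>
    ((f x - f y) ^+ 2 / norm2 (x - y) `^ ((3 + 2 * theta) / 2))%:E)).

(** H^s(Omega), for s >= 0, as the Sobolev-Slobodeckij space W^{s,2}(Omega):
    the weak derivatives of order at most k = floor(s) are in L^2 and, if s is
    not an integer, those of order k have a finite Gagliardo seminorm of
    exponent s - k. *)
Definition sobolev Omega (s : R) f : Prop :=
  let k := Num.truncn s in
  let theta := s - k%:R in
  exists D : seq 'I_3 -> 'rV[R]_3 -> R,
    [/\ D [::] = f,
        forall l, (size l <= k)%N ->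
          square_integrable Omega (D l) /\ weak_partial Omega l f (D l)
      & 0 < theta -> forall l, size l = k ->
          (gagliardo Omega theta (D l) < +oo)%E].

End Sobolev.

(** * Riemannian 3-manifolds with boundary *)

(** A chart maps the open set [dom i] onto a (relatively) open subset of R^3 or,
    if [bdry i], of the half-space {x_0 >= 0}.  [metric i m] is the Gram matrix
    of the metric at [m] in the coordinates of the chart [i]. *)
Record atlas (R : realType) (M : topologicalType) := Atlas {
  chart_index : Type;
  chart_at : M -> chart_index;
  dom : chart_index -> set M;
  bdry : chart_index -> bool;
  chart : chart_index -> M -> 'rV[R]_3;
  chart_inv : chart_index -> 'rV[R]_3 -> M;
  metric : chart_index -> M -> 'M[R]_3 }.

Section Manifold.
Context {R : realType} {M : topologicalType} (A : atlas R M).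
Local Notation I := (chart_index A).
Implicit Types (i j : I) (m : M) (f : M -> R) (D : set M).

Definition model i : set 'rV[R]_3 := [set x | bdry i ==> (0 <= x 0 0)].

Definition model_interior i : set 'rV[R]_3 :=
  [set x | bdry i ==> (0 < x 0 0)].

Definition img i : set 'rV[R]_3 := chart i @` dom i.

Definition local_coord i (k : 'I_3) : M -> R := fun m => chart i m 0 k.

(** Partial derivative of a function on M in the coordinates of the chart [i];
    it is again a function on M, meaningful on [dom i]. *)
Definition pd i (k : 'I_3) f : M -> R := fun m =>
  derive_within (img i) (f \o chart_inv i) (chart i m) (basis_vec R k).

Definition pd_exists i (k : 'I_3) f m : Prop :=
  derivable_within (img i) (f \o chart_inv i) (chart i m) (basis_vec R k).

Definition pds i (l : seq 'I_3) f : M -> R := foldr (pd i) f l.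

(** Class C^n, up to the boundary, on an open subset [D] of [dom i]. *)
Definition Cn_on i D (n : nat) f : Prop :=
  (forall l, (size l <= n)%N -> {within D, continuous (pds i l f)})
  /\ (forall l k m, (size l < n)%N -> D m -> pd_exists i k (pds i l f) m).

Definition smooth_on i D f : Prop := forall n, Cn_on i D n f.

(** Row [l] of the Jacobian matrix is the [l]-th partial derivative of the
    coordinates of chart [j]: components of vectors are rows, and transform by
    multiplication on the right. *)
Definition transition_jac i j m : 'M[R]_3 :=
  \matrix_(l, k) pd i l (local_coord j k) m.

Definition smooth_atlas : Prop :=
  [/\ forall m, dom (chart_at A m) m,
      forall i, open (dom i),
      forall i, [/\ {within dom i, continuous (chart i)},
                    {within img i, continuous (chart_inv i)}
                  & forall m, dom i m -> chart_inv i (chart i m) = m],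
      forall i, exists2 U : set 'rV[R]_3, open U & img i = U `&` model i
    & forall i j k, smooth_on i (dom i `&` dom j) (local_coord j k)].

Definition oriented : Prop :=
  forall i j m, dom i m -> dom j m -> 0 < \det (transition_jac i j m).

Definition riemannian : Prop :=
  [/\ forall i k l, smooth_on i (dom i) (fun m => metric i m k l),
      forall i m, dom i m -> (metric i m)^T = metric i m,
      forall i m (v : 'rV[R]_3), dom i m -> v != 0 ->
        0 < (v *m metric i m *m v^T) 0 0
    & forall i j m, dom i m -> dom j m ->
        metric i m
        = transition_jac i j m *m metric j m *m (transition_jac i j m)^T].

Definition connected_oriented_riemannian_manifold : Prop :=
  [/\ hausdorff_space M, connected [set: M], smooth_atlas, oriented
    & riemannian].

(** Euclidean R^3, presented by one global Cartesian chart. *)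
Definition euclidean_R3 : Prop :=
  exists i, [/\ forall j, j = i, dom i = setT, ~~ bdry i, img i = setT
              & forall m, metric i m = 1%:M].

(** ** Vector fields *)

(** [v i m] is the row of the components of the field at [m] in the chart
    [i]. *)
Definition field_rep : Type := I -> M -> 'rV[R]_3.

Implicit Types (v w K : field_rep).

Definition component v i (k : 'I_3) : M -> R := fun m => v i m 0 k.

Definition vector_field v : Prop :=
  forall i j m, dom i m -> dom j m -> v j m = v i m *m transition_jac i j m.

Definition smooth_field v : Prop :=
  vector_field v /\ forall i k, smooth_on i (dom i) (component v i k).

Definition tangent_to_boundary v : Prop :=
  forall i m, dom i m -> bdry i -> chart i m 0 0 = 0 -> v i m 0 0 = 0.

Definition inner v w : M -> R := fun m =>
  let i := chart_at A m in (v i m *m metric i m *m (w i m)^T) 0 0.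

Definition volume_density i : M -> R := fun m => Num.sqrt (\det (metric i m)).

Definition divergence_free v : Prop :=
  forall i m, dom i m ->
    (volume_density i m)^-1
      * (\sum_k pd i k (fun m' => volume_density i m' * v i m' 0 k) m) = 0.

Definition lie_bracket v w : field_rep := fun i m =>
  \row_k \sum_a (v i m 0 a * pd i a (component w i k) m
                 - w i m 0 a * pd i a (component v i k) m).

Definition christoffel i m (k a b : 'I_3) : R :=
  2^-1 * \sum_c invmx (metric i m) k c
    * (pd i a (fun m' => metric i m' b c) m
       + pd i b (fun m' => metric i m' a c) m
       - pd i c (fun m' => metric i m' a b) m).

(** Levi-Civita covariant derivative of [w] along [v]. *)
Definition nabla v w : field_rep := fun i m =>
  \row_k \sum_a v i m 0 a
    * (pd i a (component w i k) m + \sum_b christoffel i m k a b * w i m 0 b).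

Definition gradient f : field_rep := fun i m =>
  \row_k \sum_c invmx (metric i m) k c * pd i c f m.

(** L_K g = 0, in coordinates. *)
Definition killing K : Prop :=
  smooth_field K /\
  forall i m a b, dom i m ->
    \sum_c (K i m 0 c * pd i c (fun m' => metric i m' a b) m
            + metric i m c b * pd i a (component K i c) m
            + metric i m a c * pd i b (component K i c) m) = 0.

(** ** Curves and flows *)

(** The curve [c], defined on the interval [J], has velocity [v (c t)] at
    [t]. *)
Definition has_velocity (J : set R) (c : R -> M) (t : R) v : Prop :=
  c r @[r --> within J (nbhs t)] --> c t /\
  forall i k, dom i (c t) ->
    quotient_within J (fun r : R => chart i (c r) 0 k) t 1
      --> v i (c t) 0 k.

(** [c t] is the flow of the time-dependent field [u t] on [J]. *)
Definition is_flow (J : set R) (u : R -> field_rep) (c : R -> M -> M) : Prop :=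
  c 0 = id
  /\ forall t m, J t -> has_velocity J (fun r => c r m) t (u t).

(** ** Sobolev fields and diffeomorphisms *)

(** Localization in the chart [i].  The support is required to be closed in M,
    hence compact if M is; on R^3, the constant 1 is a cutoff, so that no decay
    is lost by localizing.  The bounds on the derivatives, automatic on a
    compact M, make the multiplication by [chi] continuous on H^s(R^3). *)
Definition cutoff i D (chi : M -> R) : Prop :=
  [/\ smooth_on i (dom i) chi,
      forall l, exists B : R,
        forall m, dom i m -> `|pds i l chi m| <= B
    & closure [set m | chi m != 0] `<=` D].

Definition localize i (chi f : M -> R) : 'rV[R]_3 -> R := fun x =>
  if `[< img i x >] then chi (chart_inv i x) * f (chart_inv i x) else 0.

(** H^s fields are used only for s > 5/2, where each class has a unique C^1
    representative by the Sobolev embedding theorem; this representative is the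
    one considered, so that values and brackets make sense pointwise. *)
Definition sobolev_field (s : R) v : Prop :=
  [/\ vector_field v,
      forall i k, Cn_on i (dom i) 1 (component v i k)
    & forall i k chi, cutoff i (dom i) chi ->
        sobolev (model_interior i) s (localize i chi (component v i k))].

(** Subtracting the coordinates of the identity changes nothing for a [chi]
    with compact support; on R^3 it expresses that eta - id is in H^s. *)
Definition sobolev_map (s : R) (eta : M -> M) : Prop :=
  [/\ continuous eta,
      forall i j k,
        Cn_on i (dom i `&` eta @^-1` dom j) 1 (local_coord j k \o eta)
    & forall i j k chi, cutoff i (dom i `&` eta @^-1` dom j) chi ->
        sobolev (model_interior i) s
          (localize i chi
             (fun m => local_coord j k (eta m) - local_coord i k m))].

Definition sobolev_diffeo (s : R) (eta : M -> M) : Prop :=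
  sobolev_map s eta /\
  exists zeta, [/\ cancel eta zeta, cancel zeta eta & sobolev_map s zeta].

(** Pull-back of the Riemannian volume form equal to itself. *)
Definition volume_preserving (eta : M -> M) : Prop :=
  forall i j m, dom i m -> dom j (eta m) ->
    volume_density j (eta m)
      * \det (\matrix_(l, k) pd i l (local_coord j k \o eta) m)
    = volume_density i m.

(** T_e D_mu^s, T_e A_mu^s and A_mu^s. *)
Definition solenoidal_field (s : R) v : Prop :=
  [/\ sobolev_field s v, tangent_to_boundary v & divergence_free v].

Definition axisymmetric_field K (s : R) v : Prop :=
  solenoidal_field s v /\ forall i m, dom i m -> lie_bracket K v i m = 0.

Definition axisymmetric_diffeo (phi : R -> M -> M) (s : R) (eta : M -> M)
    : Prop :=
  [/\ sobolev_diffeo s eta, volume_preserving eta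
    & forall t m, eta (phi t m) = phi t (eta m)].

Definition swirl K v : M -> R := inner v K.

(** ** Euler equations *)

(** Class C^1 jointly in time and space. *)
Definition C1_time_space (J : set R) (u : R -> field_rep) : Prop :=
  forall i k,
  [/\ {within J `*` dom i, continuous (fun z : R * M => u z.1 i z.2 0 k)},
      {within J `*` dom i, continuous (fun z : R * M =>
         derive_within J (fun r : R => u r i z.2 0 k) z.1 1)},
      forall a, {within J `*` dom i, continuous (fun z : R * M =>
         pd i a (component (u z.1) i k) z.2)}
    & forall t m, J t -> dom i m ->
        derivable_within J (fun r : R => u r i m 0 k) t 1].

Definition euler_solution (s : R) (J : set R) (u0 : field_rep)
    (u : R -> field_rep) : Prop :=
  [/\ forall t, J t -> solenoidal_field s (u t),
      C1_time_space J u,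
      forall i m, dom i m -> u 0 i m = u0 i m
    & exists p : R -> M -> R, forall t, J t ->
        (forall i, Cn_on i (dom i) 1 (p t)) /\
        forall i m k, dom i m ->
          derive_within J (fun r : R => u r i m 0 k) t 1
            + nabla (u t) (u t) i m 0 k = - gradient (p t) i m 0 k].

(** The geodesic of the right-invariant L^2 metric corresponding to a solution
    [u] of the Euler equations, as a curve in A_mu^s. *)
Definition axisymmetric_geodesic (phi : R -> M -> M) (s : R) (J : set R)
    (u : R -> field_rep) (gamma : R -> M -> M) : Prop :=
  is_flow J u gamma
  /\ forall t, J t -> axisymmetric_diffeo phi s (gamma t).

End Manifold.

(* Main.v *)
Require Import Defs.
From HB Require Import structures.
From mathcomp Require Import all_boot all_order all_algebra.
From mathcomp Require Import all_classical all_reals all_analysis.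
From mathcomp Require Import measurable_realfun ring lra.

Set Implicit Arguments.
Unset Strict Implicit.
Unset Printing Implicit Defensive.

Import Order.TTheory GRing.Theory Num.Theory numFieldNormedType.Exports.
Local Open Scope classical_set_scope.
Local Open Scope ring_scope.

(** Write y = gamma_t(m) and let phi be the flow of K.  The Euler equations and
    L_K g = 0 give d/dt <u, K>(gamma_t(m)) = - (K p)(y), so K p = 0 has to be
    shown along the orbits of K.  Since gamma_s and phi_r commute, the map
    (s, r) |-> phi_r(gamma_s(m)) = gamma_s(phi_r(m)) has partial derivatives u
    and K, and Schwarz's theorem yields [K, u] = 0.  Hence <u, K> is constant on
    the orbits of K; so is its material derivative - K p, and p grows linearly
    along these orbits: p(phi_r(y)) = p(y) + c r with c = (K p)(y).

    On a compact M, p is bounded and c = 0.  On R^3, c <> 0 forces the orbit of y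
    to be unbounded, and then all the orbits, phi_r being isometric.  The speed
    |u| is constant on orbits as well, so an H^s field u with u(z) <> 0 would be
    bounded below on translates of a fixed ball going to infinity, which its
    square integrability forbids.  So u = 0 at all interior times, the swirl
    vanishes, and c = 0 after all. *)

(** * Derivatives within a set *)

Section CalculusWithin.
Context {R : realType}.

(** Near 0 every step is admissible, so restricting the filter to steps inside [A] changes nothing.
    Results on ordinary two-sided derivatives then apply. *)
Lemma quotient_withinE (V W : normedModType R) (A : set V) (f : V -> W) x v :
    (\forall h \near (0 : R), A (h *: v + x)) ->
  quotient_within A f x v = (h^-1 *: (f (h *: v + x) - f x)) @[h --> 0^'].
Proof.
move=> An; rewrite /quotient_within; congr (_ @ _); apply/seteqP; split => B.
  rewrite /within /= => B0; near=> h.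
  have Ah : A (h *: v + x) by near: h; apply: nbhs_dnbhs.
  by move: Ah; near: h; exact: B0.
by rewrite /within /=; apply: filterS => h.
Unshelve. all: by end_near. Qed.

Lemma quotient_within_congr (V W : normedModType R) (A : set V) (f g : V -> W)
    x v : A x -> (forall y, A y -> f y = g y) ->
  quotient_within A f x v = quotient_within A g x v.
Proof.
move=> Ax fg; rewrite /quotient_within (fg _ Ax).
set F := fun h : R => h^-1 *: (f (h *: v + x) - g x).
set G := fun h : R => h^-1 *: (g (h *: v + x) - g x).
set D := [set h : R | A (h *: v + x)].
have FG : {in D, F =1 G} by move=> h; rewrite inE /F /G => Dh; rewrite fg.
have GF : {in D, G =1 F} by move=> h Dh; rewrite FG.
apply/seteqP; split.
  exact: (@fmap_within_eq _ D _ 0^' _ _ _ GF).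
exact: (@fmap_within_eq _ D _ 0^' _ _ _ FG).
Qed.

Lemma is_derive_of_quotient_within (W : normedModType R) (J : set R)
    (f : R -> W) t l :
  nbhs t J -> quotient_within J f t 1 --> l -> is_derive t (1 : R) f l.
Proof.
move=> Jt; rewrite quotient_withinE => [fl|]; last first.
  have /(_ _ Jt) : (h *: 1 + t : R) @[h --> (0 : R)] --> t.
    rewrite -[X in _ --> X]add0r -[X in X + _](scale0r (1 : R^o)).
    by apply: cvgD; [apply: cvgZr_tmp; exact: cvg_id|exact: cvg_cst].
  by [].
apply: DeriveDef.
  by apply/cvg_ex; exists l.
by apply: cvg_lim.
Qed.

Lemma is_derive_within (W : normedModType R) (J : set R) (f : R -> W) t :
    nbhs t J -> derivable_within J f t 1 ->
  is_derive t (1 : R) f (derive_within J f t 1).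
Proof. move=> Jt fd; apply: (is_derive_of_quotient_within Jt); exact: fd. Qed.

End CalculusWithin.

(** * The mean value theorem along coordinate lines inside a set *)

Section Slopes.
Context {R : realType} {n : nat}.
Implicit Types (V : set 'rV[R]_n) (g : 'rV[R]_n -> R) (x y z : 'rV[R]_n).

Lemma cvg_into_within (T U : Type) (F : set_system T) (G : set_system U)
    (f : T -> U) (V : set U) : Filter F ->
  f @ F --> G -> (\forall y \near F, V (f y)) -> f @ F --> within V G.
Proof.
move=> FF fG fV B /fG; rewrite !nbhs_filterE /fmap /= => fB.
by apply: filterS2 fV fB => t /= Vt; exact.
Qed.

Definition C1_within V g :=
  [/\ {within V, continuous g},
      forall k x, V x -> derivable_within V g x (delta_mx 0 k)
    & forall k, {within V, continuous
        (fun x => derive_within V g x (delta_mx 0 k))}].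

(** Inside the segment small steps in direction [k] stay in [V], so the derivative within [V] is
    two-sided there; at the end points only continuity is used. *)
Lemma MVT_partial V g k z (a b : R) : C1_within V g ->
    a <= b -> (forall h, a <= h <= b -> V (h *: delta_mx 0 k + z)) ->
  exists2 c, a <= c <= b & g (b *: delta_mx 0 k + z) - g (a *: delta_mx 0 k + z)
    = derive_within V g (c *: delta_mx 0 k + z) (delta_mx 0 k) * (b - a).
Proof.
move=> [gc gd _] ab Vz.
have [||c] := @MVT_segment R (fun h => g (h *: delta_mx 0 k + z))
    (fun c => derive_within V g (c *: delta_mx 0 k + z) (delta_mx 0 k)) _ _ ab.
- move=> h; rewrite in_itv /= => /andP[ah hb].
  have nV : \forall s \near (0 : R),
      V (s *: delta_mx 0 k + (h *: delta_mx 0 k + z)).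
    near=> s; rewrite addrA -scalerDl; apply: Vz.
    have : `|s| < h - a by near: s; apply: (@nbhs0_lt R R^o); rewrite subr_gt0.
    have : `|s| < b - h by near: s; apply: (@nbhs0_lt R R^o); rewrite subr_gt0.
    by rewrite !ltr_norml => /andP[? ?] /andP[? ?]; lra.
  have Vh : V (h *: delta_mx 0 k + z) by apply: Vz; rewrite !ltW.
  have := gd k _ Vh; rewrite /derivable_within /derive_within.
  have /= qE := quotient_withinE g nV.
  rewrite qE => gdh.
  have quoE : (fun s : R => s^-1 *:
        (g ((s *: 1 + h) *: delta_mx 0 k + z) - g (h *: delta_mx 0 k + z)))
      = (fun s : R => s^-1 *: (g (s *: delta_mx 0 k + (h *: delta_mx 0 k + z))
           - g (h *: delta_mx 0 k + z))).
    by apply/funext => s; rewrite addrA -scalerDl -[s *: 1]/(s * 1) mulr1.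
  by apply: DeriveDef; rewrite /derivable /derive /= quoE.
- apply/subspace_continuousP => h; rewrite /= in_itv /= => hab.
  move/subspace_continuousP: gc => /(_ _ (Vz _ hab)); apply: cvg_trans.
  have : (r *: delta_mx 0 k + z) @[r --> within `[a, b] (nbhs h)]
      --> within V (nbhs (h *: delta_mx 0 k + z)).
    apply: cvg_into_within.
      apply: cvg_within_filter.
      by apply: cvgD; [apply: cvgZr_tmp; exact: cvg_id|exact: cvg_cst].
    by apply: filterS (withinT _ _) => r /=; rewrite in_itv; exact: Vz.
  exact: (cvg_app g).
by rewrite in_itv /= => hc ->; exists c.
Unshelve. all: by end_near. Qed.

End Slopes.

(** * The chain rule within a set, valid at boundary points *)

Section Chain.
Context {R : realType} {n : nat}.
Implicit Types (V : set 'rV[R]_n) (g : 'rV[R]_n -> R) (x y z : 'rV[R]_n).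

Lemma cvg_sumr (I T : Type) (F : set_system T) (r : seq I) (P : pred I)
    (f : I -> T -> R) (l : I -> R) : Filter F ->
  (forall i, P i -> f i @ F --> l i) ->
  (\sum_(i <- r | P i) f i t) @[t --> F] --> \sum_(i <- r | P i) l i.
Proof.
move=> FF fl; elim: r => [|i r IH].
  by rewrite big_nil; under eq_cvg do rewrite big_nil; exact: cvg_cst.
rewrite big_cons; under eq_cvg do rewrite big_cons.
by case: ifPn => // Pi; apply: cvgD => //; exact: fl.
Qed.

Lemma rV_ballP x y (e : R) : 0 < e ->
  ball x e y <-> (forall k, `|x 0 k - y 0 k| < e).
Proof.
move=> e0; split=> [[_ xy] k|xy]; first exact: xy.
by split=> // i j; rewrite (ord1 i); exact: xy.
Qed.

(** The closed coordinate box with opposite corners [x] and [y]. It contains every path from [x] to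
    [y] that changes one coordinate at a time monotonically. *)
Definition between x y (w : 'rV[R]_n) :=
  forall k, Num.min (x 0 k) (y 0 k) <= w 0 k <= Num.max (x 0 k) (y 0 k).

Lemma MVT_partial_sym V g k z (a b : R) : C1_within V g ->
    (forall h, Num.min a b <= h <= Num.max a b -> V (h *: delta_mx 0 k + z)) ->
  exists2 c, Num.min a b <= c <= Num.max a b &
    g (b *: delta_mx 0 k + z) - g (a *: delta_mx 0 k + z)
    = derive_within V g (c *: delta_mx 0 k + z) (delta_mx 0 k) * (b - a).
Proof.
move=> gC1; have [ab|ba] := leP a b => Vz; first exact: MVT_partial.
have [c cab eq_c] := MVT_partial gC1 (ltW ba) Vz.
by exists c => //; rewrite -opprB eq_c -mulrN opprB.
Qed.

(* Going from [x] to [y] one coordinate at a time, the box spanned by [x] and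
   [y] being contained in [V], reduces this to the mean value theorem. *)
Lemma slopes_within V g x : V x -> C1_within V g ->
    (\forall y \near within V (nbhs x), between x y `<=` V) ->
  exists a : 'I_n -> 'rV[R]_n -> R,
    (forall k, a k y @[y --> within V (nbhs x)]
       --> derive_within V g x (delta_mx 0 k)) /\
    forall y, g y - g x = \sum_k (y 0 k - x 0 k) * a k y.
Proof.
move=> Vx gC1 boxV.
pose P (y : 'rV[R]_n) (j : nat) : 'rV[R]_n :=
  \row_k (if (k < j)%N then y 0 k else x 0 k).
pose w (y : 'rV[R]_n) (j : 'I_n) : 'rV[R]_n :=
  \row_k (if k == j then 0 else P y j 0 k).
have Pw y (j : 'I_n) : P y j = x 0 j *: delta_mx 0 j + w y j.
  apply/rowP => k; rewrite !mxE eqxx /=.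
  by have [->|] := eqVneq k j; rewrite ?ltnn /= ?mulr1 ?addr0 // mulr0 add0r.
have PSw y (j : 'I_n) : P y j.+1 = y 0 j *: delta_mx 0 j + w y j.
  apply/rowP => k; rewrite !mxE eqxx /=.
  have [->|kj] := eqVneq k j; rewrite /= ?ltnSn ?mulr1 ?addr0 //.
  by rewrite mulr0 add0r ltnS leq_eqVlt -[(k == j :> nat)]/(k == j) (negbTE kj).
(* Where [y] and [x] share coordinate [k] the difference quotient is 0/0; the partial derivative at
   [x] is the value that keeps [a k] convergent. *)
pose a k y := if y 0 k == x 0 k then derive_within V g x (delta_mx 0 k)
  else (g (P y k.+1) - g (P y k)) / (y 0 k - x 0 k).
exists a; split=> [k|y]; last first.
  have P0 : P y 0%N = x by apply/rowP => k; rewrite mxE ltn0.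
  have Pn : P y n = y by apply/rowP => k; rewrite mxE ltn_ord.
  rewrite -[in LHS]Pn -[in X in _ - X]P0 -(@telescope_sumr _ 0 n (g \o P y)) //.
  rewrite big_mkord; apply: eq_bigr => j _ /=; rewrite /a; case: eqP => [yx|/eqP yx].
    by rewrite PSw Pw yx !subrr mul0r.
  by rewrite mulrC divfK // subr_eq0.
apply/cvgrPdist_lt => e e0; have [_ _ dc] := gC1.
have := dc k; move/subspace_continuousP => /(_ _ Vx) /cvgrPdist_lt /(_ e e0).
rewrite {1}/within /= => /nbhs_ballP[d /= d0 dV].
have xd : \forall y \near within V (nbhs x), ball x d y.
  by apply: cvg_within; exact: nbhsx_ballx.
near=> y; rewrite /a; case: eqP => [yx|/eqP yx]; first by rewrite subrr normr0.
have bet h : Num.min (x 0 k) (y 0 k) <= h <= Num.max (x 0 k) (y 0 k) ->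
    between x y (h *: delta_mx 0 k + w y k).
  move=> hxy l; rewrite !mxE eqxx /=; have [->|] := eqVneq l k.
    by rewrite mulr1 addr0.
  rewrite mulr0 add0r; case: ifP => _ _.
    by rewrite ge_min le_max !lexx !orbT.
  by rewrite ge_min le_max !lexx.
have bV : between x y `<=` V by near: y.
have [|c cxy] := @MVT_partial_sym V g k (w y k) (x 0 k) (y 0 k) gC1.
  by move=> h /bet; exact: bV.
rewrite -Pw -PSw => ->; rewrite mulfK ?subr_eq0 //.
apply: dV; last by apply: bV; exact: bet.
apply/(rV_ballP _ _ d0) => l; apply: le_lt_trans (_ : `|x 0 l - y 0 l| < d).
  set q := (c *: _ + _); have {}cxy : between x y q := bet _ cxy.
  move: (cxy l); move: (q 0 l) => {cxy}{}q.
  have := ler_norm (x 0 l - y 0 l); have := ler_norm (y 0 l - x 0 l).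
  rewrite [`|y 0 l - _|]distrC => n1 n2.
  by have [xy|xy] := leP (x 0 l) (y 0 l) => /andP[q1 q2]; rewrite ler_norml;
    apply/andP; split; lra.
have : ball x d y by near: y.
by move/(rV_ballP _ _ d0).
Unshelve. all: by end_near. Qed.

(** The slopes do the work of a differential, which makes no sense in all directions at a boundary
    point: divide the slope identity along [c] by [h] and pass to the limit. *)
Lemma is_derive_chain_within V g (c : R -> 'rV[R]_n) t (v : 'I_n -> R) :
    V (c t) -> C1_within V g ->
    (\forall y \near within V (nbhs (c t)), between (c t) y `<=` V) ->
    (\forall r \near t, V (c r)) ->
    (forall k, is_derive t (1 : R) (fun r => c r 0 k) (v k)) ->
  is_derive t (1 : R) (g \o c)
    (\sum_k v k * derive_within V g (c t) (delta_mx 0 k)).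
Proof.
move=> Vct gC1 boxV Vc dc.
have [a [acvg ga]] := slopes_within Vct gC1 boxV.
have cc : c r @[r --> t] --> within V (nbhs (c t)).
  apply: cvg_into_within => //; apply/cvg_ballP => e e0; near=> r.
  apply/(rV_ballP _ _ e0); near: r; apply: filter_forall => k.
  suff : (fun r => c r 0 k) @ t --> c t 0 k by move/cvgrPdist_lt; exact.
  by apply: differentiable_continuous; apply/derivable1_diffP; case: (dc k).
have ht : (h *: (1 : R) + t) @[h --> (0 : R)^'] --> t.
  rewrite -[X in _ --> X]add0r -[X in X + _](scale0r (1 : R^o)).
  apply: cvgD; last exact: cvg_cst.
  apply: cvgZr_tmp; exact: nbhs_dnbhs.
have quo : h^-1 *: (g (c (h *: 1 + t)) - g (c t)) @[h --> (0 : R)^']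
    --> \sum_k v k * derive_within V g (c t) (delta_mx 0 k).
  have qE h : h^-1 *: (g (c (h *: 1 + t)) - g (c t)) =
      \sum_k (h^-1 *: (c (h *: 1 + t) 0 k - c t 0 k)) * a k (c (h *: 1 + t)).
    by rewrite ga scaler_sumr; apply: eq_bigr => k _; rewrite -scalerAl.
  under eq_cvg do rewrite qE.
  apply: cvg_sumr => k _; apply: cvgM.
    by case: (dc k) => dck <-; exact: dck.
  have := cvg_comp _ _ ht cc => htc.
  exact: (cvg_comp _ _ htc (acvg k)).
by apply: DeriveDef; [apply/cvg_ex; eexists; exact: quo|apply: cvg_lim quo].
Unshelve. all: by end_near. Qed.

End Chain.

(** * Functions of two real variables: diagonal derivatives and Schwarz's theorem *)

Section TwoVariables.
Context {R : realType}.

Lemma MVT_sym (f df : R -> R) (a b : R) :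
    (forall x, Num.min a b <= x <= Num.max a b -> is_derive x (1 : R) f (df x)) ->
  exists2 c, Num.min a b <= c <= Num.max a b & f b - f a = df c * (b - a).
Proof.
have mvt (p q : R) : p <= q -> (forall x, p <= x <= q -> is_derive x (1 : R) f (df x)) ->
    exists2 c, p <= c <= q & f q - f p = df c * (q - p).
  move=> pq fd; have [||c] := @MVT_segment R f df p q pq.
  - by move=> x; rewrite in_itv /= => /andP[px xq]; apply: fd; rewrite !ltW.
  - apply: derivable_within_continuous => x; rewrite in_itv /= => /fd.
    by case.
  - by rewrite in_itv /= => pcq ->; exists c.
have [ab|/ltW ba] := leP a b; first exact: mvt.
by move=> /(mvt _ _ ba)[c ? E]; exists c => //; rewrite -opprB E -mulrN opprB.
Qed.

Lemma nbhs_pairP (a b : R) (D : set (R * R)) :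
  nbhs (a, b) D -> exists2 e : R, 0 < e &
    forall s r, `|s - a| < e -> `|r - b| < e -> D (s, r).
Proof.
move=> /nbhs_ballP[e /= e0 De]; exists e => // s r sa rb.
by apply: De; split; rewrite /ball /= distrC.
Qed.

Lemma is_derive_diagonal (H Hs : R -> R -> R) t d :
    (\forall z \near (t, t), is_derive z.1 (1 : R) (H^~ z.2) (Hs z.1 z.2)) ->
    Hs z.1 z.2 @[z --> (t, t)] --> Hs t t ->
    is_derive t (1 : R) (H t) d ->
  is_derive t (1 : R) (fun r => H r r) (Hs t t + d).
Proof.
move=> dH cHs dHt.
have quo : h^-1 *: (H (h *: 1 + t) (h *: 1 + t) - H t t) @[h --> (0 : R)^']
    --> Hs t t + d.
  have qE h : h^-1 *: (H (h *: 1 + t) (h *: 1 + t) - H t t) =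
      h^-1 *: (H (h *: 1 + t) (h *: 1 + t) - H t (h *: 1 + t))
      + h^-1 *: (H t (h *: 1 + t) - H t t).
    by rewrite -scalerDr; congr (_ *: _); ring.
  under eq_cvg do rewrite qE.
  apply: cvgD; last by case: dHt => dHt <-; exact: dHt.
  apply/cvgrPdist_lt => e e0; move/cvgrPdist_lt: cHs => /(_ e e0) cHs.
  have [r r0 Hr] := nbhs_pairP (filterI dH cHs).
  near=> h.
  have hr : `|h| < r by near: h; apply: (@dnbhs0_lt R R^o).
  have h0 : h != 0 by near: h; exact: nbhs_dnbhs_neq.
  have hE : h *: (1 : R) + t = h + t by rewrite -[h *: 1]/(h * 1) mulr1.
  have bet (x : R) : Num.min t (h + t) <= x <= Num.max t (h + t) -> `|x - t| < r.
    rewrite ltr_norml; move: hr; rewrite ltr_norml => /andP[? ?].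
    by have [?|?] := leP t (h + t) => /andP[? ?]; apply/andP; split; lra.
  have htr : `|h + t - t| < r by rewrite addrK.
  have [|c /bet ct] := @MVT_sym (H^~ (h + t)) (Hs^~ (h + t)) t (h + t).
    by move=> x /bet xr; have [/=] := Hr _ _ xr htr.
  rewrite hE addrK => ->.
  rewrite -[_ *: _]/(_ * _) mulrCA mulVf // mulr1.
  by have [/=] := Hr _ _ ct htr.
by apply: DeriveDef; [apply/cvg_ex; eexists; exact: quo|apply: cvg_lim quo].
Unshelve. all: by end_near. Qed.

(** Schwarz's theorem. The second difference of [F] over a square of side [h] equals [h * h] times a
    value of [A], and also [h * h] times a value of [B], by the mean value theorem in either order;
    both values are close to those at the corner. *)
Lemma mixed_partials (F P Q A B : R -> R -> R) a b :
    (\forall z \near (a, b),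
      [/\ is_derive z.1 (1 : R) (F^~ z.2) (P z.1 z.2),
          is_derive z.2 (1 : R) (F z.1) (Q z.1 z.2),
          is_derive z.2 (1 : R) (P z.1) (A z.1 z.2)
        & is_derive z.1 (1 : R) (Q^~ z.2) (B z.1 z.2)]) ->
    A z.1 z.2 @[z --> (a, b)] --> A a b ->
    B z.1 z.2 @[z --> (a, b)] --> B a b ->
  A a b = B a b.
Proof.
move=> dF cA cB; apply/eqP; rewrite -subr_eq0 -normr_le0.
apply/ler_addgt0Pl => e e0; rewrite addr0.
have e2 : 0 < e / 2 by rewrite divr_gt0.
move/cvgrPdist_lt: cA => /(_ _ e2) cA; move/cvgrPdist_lt: cB => /(_ _ e2) cB.
have [r r0 Hr] := nbhs_pairP (filterI dF (filterI cA cB)).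
pose h := r / 2; have h0 : 0 < h by rewrite divr_gt0.
have bet (y x : R) : Num.min y (y + h) <= x <= Num.max y (y + h) -> `|x - y| < r.
  rewrite /h min_l ?max_r ?lerDl ?(ltW h0) // ltr_norml => /andP[? ?].
  by move: h0; rewrite /h => ?; apply/andP; split; lra.
have nr (y : R) : `|y - y| < r by rewrite subrr normr0.
have hr (y : R) : `|y + h - y| < r by rewrite addrC addKr gtr0_norm // /h; lra.
have [|s /bet sa Es] := @MVT_sym (fun s => F s (b + h) - F s b)
    (fun s => P s (b + h) - P s b) a (a + h).
  move=> s /bet sr; apply: is_deriveB.
    by have [[]] := Hr _ _ sr (hr b).
  by have [[]] := Hr _ _ sr (nr b).
have [|q /bet qb Eq] := @MVT_sym (P s) (A s) b (b + h).
  by move=> q /bet qr; have [[]] := Hr _ _ sa qr.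
have [|q' /bet qb' Eq'] := @MVT_sym (fun q => F (a + h) q - F a q)
    (fun q => Q (a + h) q - Q a q) b (b + h).
  move=> q' /bet qr; apply: is_deriveB.
    by have [[]] := Hr _ _ (hr a) qr.
  by have [[]] := Hr _ _ (nr a) qr.
have [|s' /bet sa' Es'] := @MVT_sym (Q^~ q') (B^~ q') a (a + h).
  by move=> s' /bet sr; have [[]] := Hr _ _ sr qb'.
have [_ [/= Asq _]] := Hr _ _ sa qb; have [_ [/= _ Bsq]] := Hr _ _ sa' qb'.
have AB : A s q = B s' q'.
  apply: (@mulIf _ (h * h)); first by rewrite mulf_neq0 // gt_eqF.
  have hE (y : R) : y + h - y = h by ring.
  move: Es Eq Eq' Es'; rewrite !hE => E1 E2 E3 E4.
  rewrite mulrA -E2 -E1 mulrA -E4 -E3; ring.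
rewrite (_ : _ - _ = (A a b - A s q) - (B a b - B s' q')); last by rewrite AB; ring.
apply: le_trans (ler_normB _ _) _; lra.
Qed.

End TwoVariables.

(** * Calculus in charts *)

Section Charts.
Context {R : realType} {M : topologicalType} {A : atlas R M}.
Hypothesis hA : smooth_atlas A.
Implicit Types (i j : chart_index A) (m : M) (f : M -> R).

Lemma dom_open i : open (dom i).
Proof. by case: hA. Qed.

Lemma dom_nbhs i m : dom i m -> nbhs m (dom i).
Proof. by move=> im; apply: open_nbhs_nbhs; split => //; exact: dom_open. Qed.

Lemma chartK i m : dom i m -> chart_inv i (chart i m) = m.
Proof. by case: hA => _ _ /(_ i)[_ _ /(_ m)] + _ _; exact. Qed.

Lemma img_chart i m : dom i m -> img i (chart i m).
Proof. by move=> im; exists m. Qed.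

Lemma dom_chart_inv i x : img i x -> dom i (chart_inv i x).
Proof. by move=> [m im <-]; rewrite chartK. Qed.

Lemma chart_invK i x : img i x -> chart i (chart_inv i x) = x.
Proof. by move=> [m im <-]; rewrite chartK. Qed.

Lemma chart_cvg i m : dom i m -> chart i x @[x --> m] --> chart i m.
Proof.
move=> im; have [_ _ /(_ i)[+ _ _] _ _] := hA.
move/subspace_continuousP => /(_ _ im); rewrite within_interior //.
exact: dom_nbhs.
Qed.

Lemma chart_inv_cvg i x : img i x ->
  chart_inv i y @[y --> within (img i) (nbhs x)] --> chart_inv i x.
Proof.
by move=> ix; have [_ _ /(_ i)[_ + _] _ _] := hA; move/subspace_continuousP; exact.
Qed.

Lemma within_dom_continuous (T : topologicalType) i (f : M -> T) m :
  dom i m -> {within dom i, continuous f} -> f @ m --> f m.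
Proof.
move=> im /subspace_continuousP /(_ _ im); rewrite within_interior //.
exact: dom_nbhs.
Qed.

(** The image is an open set cut by a half-space or by nothing: balls of row vectors are boxes, and
    a box with two opposite corners in the half-space lies in it. *)
Lemma img_between i x : img i x ->
  \forall y \near within (img i) (nbhs x), between x y `<=` img i.
Proof.
move=> ix; have [_ _ _ /(_ i)[U Uo iU] _] := hA.
move: (ix); rewrite {1}iU => -[Ux mx].
have /nbhs_ballP[d /= d0 dU] : nbhs x U by apply: open_nbhs_nbhs.
have xd : \forall y \near within (img i) (nbhs x), ball x d y.
  by apply: cvg_within; exact: nbhsx_ballx.
near=> y => w xyw; have iy : img i y by near: y; exact: withinT.
move: iy; rewrite iU => -[Uy my]; split.
  apply: dU; apply/(rV_ballP _ _ d0) => k.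
  have /(rV_ballP _ _ d0)/(_ k) : ball x d y by near: y.
  have := xyw k; rewrite !ltr_norml => + /andP[? ?].
  by have [?|?] := leP (x 0 k) (y 0 k) => /andP[? ?]; apply/andP; split; lra.
apply/implyP => bi; have /andP[+ _] := xyw 0; apply: le_trans.
by rewrite le_min (implyP mx bi) (implyP my bi).
Unshelve. all: by end_near. Qed.

Lemma pdE i k f x : img i x -> pd i k f (chart_inv i x) =
  derive_within (img i) (f \o chart_inv i) x (basis_vec R k).
Proof. by move=> ix; rewrite /pd chart_invK. Qed.

Lemma continuous_chart_inv_comp i f : {within dom i, continuous f} ->
  {within img i, continuous (f \o chart_inv i)}.
Proof.
move=> fc; apply/subspace_continuousP => x ix.
have fx := within_dom_continuous (dom_chart_inv ix) fc.
exact: (cvg_comp _ _ (chart_inv_cvg ix) fx).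
Qed.

Lemma C1_within_img i f : Cn_on i (dom i) 1 f ->
  C1_within (img i) (f \o chart_inv i).
Proof.
move=> [fc fd]; split.
- exact: continuous_chart_inv_comp (fc [::] isT).
- move=> k x ix; have := fd [::] k _ isT (dom_chart_inv ix).
  by rewrite /pd_exists /= chart_invK.
- move=> k; have := continuous_chart_inv_comp (fc [:: k] isT).
  apply: subspace_eq_continuous => x; rewrite inE => ix.
  by rewrite /from_subspace /= pdE.
Qed.

Lemma pd_congr i k f g m : dom i m -> (forall m', dom i m' -> f m' = g m') ->
  pd i k f m = pd i k g m.
Proof.
move=> im fg; rewrite /pd /derive_within; congr (lim _).
by apply: quotient_within_congr; [exact: img_chart|
  move=> y iy /=; apply: fg; exact: dom_chart_inv].
Qed.

(** The chain rule within [img i], read in the chart; curves running along the boundary are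
    therefore covered. *)
Lemma is_derive_curve i f (c : R -> M) t (v : 'rV[R]_3) :
    dom i (c t) -> Cn_on i (dom i) 1 f -> c r @[r --> t] --> c t ->
    (forall k, is_derive t (1 : R) (fun r => chart i (c r) 0 k) (v 0 k)) ->
  is_derive t (1 : R) (f \o c) (\sum_k v 0 k * pd i k f (c t)).
Proof.
move=> ict fC1 cc dc.
have ic : \forall r \near t, dom i (c r) by apply: cc; exact: dom_nbhs.
have iimg : img i (chart i (c t)) by exact: img_chart.
have := @is_derive_chain_within _ _ _ _ (chart i \o c) t (v 0) iimg
  (C1_within_img fC1) (img_between iimg).
have Vc : \forall r \near t, img i (chart i (c r)).
  by apply: filterS ic => r; exact: img_chart.
move=> /(_ Vc dc) dfc.
apply: near_eq_is_derive dfc; near=> r; rewrite /= chartK //; near: r; exact: ic.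
Unshelve. all: by end_near. Qed.

Lemma has_velocity_is_derive (J : set R) (c : R -> M) t v :
    nbhs t J -> has_velocity J c t v ->
  c r @[r --> t] --> c t /\
  forall i k, dom i (c t) ->
    is_derive t (1 : R) (fun r => chart i (c r) 0 k) (v i (c t) 0 k).
Proof.
move=> Jt [cc cv]; split; first by move: cc; rewrite within_interior.
by move=> i k ict; apply: (is_derive_of_quotient_within Jt); exact: cv.
Qed.

End Charts.

(** * The Killing equation and the swirl *)

Section KillingAlgebra.
Context {R : realFieldType}.
Variables (G : 'I_3 -> 'I_3 -> R) (dG : 'I_3 -> 'I_3 -> 'I_3 -> R).
Variables (K : 'I_3 -> R) (dK : 'I_3 -> 'I_3 -> R).
Hypothesis killingK : forall a b,
  \sum_c (K c * dG c a b + G c b * dK a c + G a c * dK b c) = 0.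

(* The derivative along [K] of [g(u, K)] is [(L_K g)(u, K)] when [K] and [u]
   commute. *)
Lemma swirl_orbit_algebra (u : 'I_3 -> R) (du : 'I_3 -> 'I_3 -> R) :
    (forall k, \sum_a K a * du a k = \sum_a u a * dK a k) ->
  \sum_a \sum_b ((\sum_c K c * du c a) * G a b * K b
                 + u a * (\sum_c K c * dG c a b) * K b
                 + u a * G a b * (\sum_c K c * dK c b)) = 0.
Proof.
move=> brk.
transitivity (\sum_a \sum_b u a * K b *
    \sum_c (K c * dG c a b + G c b * dK a c + G a c * dK b c)); last first.
  by rewrite big1 // => a _; rewrite big1 // => b _; rewrite killingK mulr0.
under eq_bigr => a _ do under eq_bigr => b _ do rewrite brk.
by rewrite !big_ord_recl !big_ord0; ring.
Qed.

(* The derivative along [u] of [g(u, K)] is [g(u', K) + (L_K g)(u, u) / 2]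
   once the acceleration [u'] is expressed with the Christoffel symbols. *)
Lemma swirl_flow_algebra (X u dp : 'I_3 -> R) :
    (forall a b, G a b = G b a) -> (forall c a b, dG c a b = dG c b a) ->
    (forall l, \sum_k G l k * X k = - (dp l + 2^-1 *
       \sum_a \sum_b (dG a b l + dG b a l - dG l a b) * u a * u b)) ->
  \sum_a \sum_b (X a * G a b * K b
                 + u a * (\sum_c u c * dG c a b) * K b
                 + u a * G a b * (\sum_c u c * dK c b))
  = - \sum_c K c * dp c.
Proof.
move=> Gsym dGsym GX.
have XE : \sum_a \sum_b X a * G a b * K b = - \sum_b K b * (dp b + 2^-1 *
    \sum_a \sum_c (dG a c b + dG c a b - dG b a c) * u a * u c).
  rewrite exchange_big -sumrN; apply: eq_bigr => b _ /=.
  rewrite -mulrN -GX mulr_sumr; apply: eq_bigr => a _.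
  by rewrite (Gsym a); ring.
have kuu : \sum_a \sum_b u a * u b *
    \sum_c (K c * dG c a b + G c b * dK a c + G a c * dK b c) = 0.
  by rewrite big1 // => a _; rewrite big1 // => b _; rewrite killingK mulr0.
transitivity (- (\sum_c K c * dp c) + 2^-1 * \sum_a \sum_b u a * u b *
    \sum_c (K c * dG c a b + G c b * dK a c + G a c * dK b c)); last first.
  by rewrite kuu mulr0 addr0.
under eq_bigr => a _ do under eq_bigr => b _ do rewrite -addrA.
under eq_bigr => a _ do rewrite big_split /=.
rewrite big_split /= XE.
rewrite !big_ord_recl !big_ord0.
set i0 : 'I_3 := ord0; set i1 : 'I_3 := lift ord0 (ord0 : 'I_2).
set i2 : 'I_3 := lift ord0 (lift (ord0 : 'I_2) (ord0 : 'I_1)).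
(* The symmetries are oriented on the three pairs of distinct indices, so that equal monomials
   become syntactically equal. *)
rewrite (Gsym i1 i0) (Gsym i2 i0) (Gsym i2 i1).
rewrite !(dGsym _ i1 i0) !(dGsym _ i2 i0) !(dGsym _ i2 i1).
by field.
Qed.

End KillingAlgebra.

(** * Derivatives of sums and of bilinear forms with varying coefficients *)

Section DeriveSums.
Context {R : realType}.

Lemma is_derive_sumE n (f : 'I_n -> R -> R) (df : 'I_n -> R) t :
    (forall k, is_derive t (1 : R) (f k) (df k)) ->
  is_derive t (1 : R) (fun r => \sum_k f k r) (\sum_k df k).
Proof.
move=> fd; rewrite (_ : (fun r => _) = \sum_k f k); first exact: is_derive_sum.
by apply/funext => r; rewrite fct_sumE.
Qed.

(** Meant for g(u, K) along a curve: [f] and [h] are the components of the fields, [g] the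
    coefficients of the metric. *)
Lemma is_derive_bilinear n (f h : 'I_n -> R -> R) (g : 'I_n -> 'I_n -> R -> R)
    (f' h' : 'I_n -> R) (g' : 'I_n -> 'I_n -> R) t :
    (forall a, is_derive t (1 : R) (f a) (f' a)) ->
    (forall a b, is_derive t (1 : R) (g a b) (g' a b)) ->
    (forall b, is_derive t (1 : R) (h b) (h' b)) ->
  is_derive t (1 : R) (fun r => \sum_a \sum_b f a r * g a b r * h b r)
    (\sum_a \sum_b (f' a * g a b t * h b t + f a t * g' a b * h b t
                    + f a t * g a b t * h' b)).
Proof.
move=> df dg dh; apply: is_derive_sumE => a; apply: is_derive_sumE => b.
have D := is_deriveM (is_deriveM (df a) (dg a b)) (dh b).
apply: (is_derive_eq D); rewrite -[(f a * g a b) t]/(f a t * g a b t).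
by rewrite /GRing.scale /=; ring.
Qed.

End DeriveSums.

(** * Joint continuity of the flow of the Killing field *)

Section FlowContinuity.
Context {R : realType} {M : topologicalType} {A : atlas R M}.
Hypotheses (hA : smooth_atlas A) (hM : hausdorff_space M).

(** Continuous induction: at the infimum of the failures [O] holds by the step hypothesis, hence
    also just after it, so failures cannot accumulate there. *)
Lemma interval_induction (O : set R) (b : R) :
    (forall r, 0 <= r -> O r -> nbhs r O) -> O 0 ->
    (forall r, 0 < r <= b -> (forall q, 0 <= q < r -> O q) -> O r) ->
  forall r, 0 <= r <= b -> O r.
Proof.
move=> Oo O0 Ostep r1 /andP[r10 r1b]; apply: contrapT => Or1.
pose E := [set r | 0 <= r <= b /\ ~ O r].
have Er1 : E r1 by split => //; rewrite r10.
have Einf : has_inf E.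
  by split; [exists r1|exists 0 => r [/andP[]]].
have Elb r : E r -> inf E <= r by move=> Er; apply: ge_inf => //; case: Einf.
have inf0 : 0 <= inf E by apply: lb_le_inf => [|r [/andP[]]]; first by exists r1.
have below q : 0 <= q < inf E -> O q.
  move=> /andP[q0 qE]; apply: contrapT => Oq.
  have : E q by split => //; rewrite q0 (le_trans (ltW qE)) // (le_trans (Elb _ Er1)).
  by move=> /Elb; rewrite leNgt qE.
have Oinf : O (inf E).
  have [<-//|inf_neq0] := eqVneq 0 (inf E).
  apply: Ostep => //; rewrite lt_neqAle inf_neq0 inf0 /=.
  by rewrite (le_trans (Elb _ Er1)).
have /nbhs_ballP[e /= e0 eO] := Oo _ inf0 Oinf.
have [r Er re] := inf_adherent e0 Einf.
case: Er (Elb _ Er) => _ Or infr; apply: Or; apply: eO.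
by rewrite /ball /= ler0_norm ?subr_le0 // opprB ltrBlDl.
Qed.

Variable i : chart_index A.
Variables (x : 'rV[R]_3) (d : R).

Definition chart_box : set M :=
  [set m | dom i m /\ forall k, `|chart i m 0 k - x 0 k| < d].

Definition closed_chart_box : set M :=
  [set m | dom i m /\ forall k, `|chart i m 0 k - x 0 k| <= d].

Lemma chart_coord_cvg m k : dom i m -> chart i m' 0 k @[m' --> m] --> chart i m 0 k.
Proof.
move=> im; have cc := chart_cvg hA im.
exact: (cvg_comp _ _ cc (@coord_continuous R 1 3 0 k _)).
Qed.

Lemma chart_box_nbhs m : chart_box m -> nbhs m chart_box.
Proof.
move=> [im md]; apply: filterI; first exact: dom_nbhs.
apply: filter_forall => k.
have e0 : 0 < d - `|chart i m 0 k - x 0 k| by rewrite subr_gt0.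
move/cvgrPdist_lt: (@chart_coord_cvg _ k im) => /(_ _ e0).
apply: filterS => m' mm'.
rewrite -(subrKA (chart i m 0 k)) (le_lt_trans (ler_normD _ _)) //.
by rewrite distrC -ltrBrDr.
Qed.

(** A closed box in coordinates need not be closed in [M], as [dom i] is merely open. Here it is the
    continuous image of a compact subset of the model, hence compact, hence closed since [M] is
    Hausdorff. *)
Lemma closed_chart_box_closed :
    (forall y : 'rV[R]_3, (forall k, `|y 0 k - x 0 k| <= d) -> model i y -> img i y) ->
  closed closed_chart_box.
Proof.
move=> boximg; apply: compact_closed => //.
pose B : set 'rV[R]_3 :=
  [set y : 'rV[R]_3 | forall k, `[x 0 k - d, x 0 k + d]%classic (y 0 k)] `&` model i.
have BE (y : 'rV[R]_3) : B y <-> (forall k, `|y 0 k - x 0 k| <= d) /\ model i y.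
  by split=> -[yx my]; split => // k; move: (yx k); rewrite /= in_itv /= ler_distl.
have Bimg : B `<=` img i by move=> y /BE[]; exact: boximg.
have -> : closed_chart_box = chart_inv i @` B.
  apply/seteqP; split => [m [im md]|m [y By <-]].
    exists (chart i m); last by rewrite (chartK hA).
    apply/BE; split => //; have [_ _ _ /(_ i)[U _ iU] _] := hA.
    by have := img_chart im; rewrite iU => -[].
  have iy := Bimg _ By; split; first exact: (dom_chart_inv hA).
  by rewrite (chart_invK hA) //; case/BE: By.
apply: continuous_compact.
  have [_ _ /(_ i)[_ + _] _ _] := hA; exact: continuous_subspaceW.
apply: compact_closedI.
  by apply: (@rV_compact R 3 (fun k => `[x 0 k - d, x 0 k + d]%classic)) => k;
    exact: segment_compact.
have -> : model i = if bdry i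
    then (fun y : 'rV[R]_3 => y 0 0) @^-1` [set r | 0 <= r] else setT.
  by rewrite /model; case: (bdry i) => //; apply/seteqP; split.
case: ifP => _; last exact: closedT.
apply: preimage_closed.
  by move=> y _; exact: coord_continuous.
exact: closed_ge.
Qed.

(* A curve needs time at least [d / (2 C)] to leave a chart box in which its
   coordinates have velocity at most [C]. *)
Lemma curve_stays_in_box (c : R -> M) (dc : R -> 'I_3 -> R) (C : R) :
    closed closed_chart_box -> continuous c -> 0 <= C ->
    (forall r, closed_chart_box (c r) -> forall k,
      is_derive r (1 : R) (fun q => chart i (c q) 0 k) (dc r k)
      /\ `|dc r k| <= C) ->
    dom i (c 0) -> (forall k, `|chart i (c 0) 0 k - x 0 k| < d / 2) ->
  forall b, b * C < d / 2 -> forall r, 0 <= r <= b -> chart_box (c r).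
Proof.
move=> Qcl cc C0 dcC ic0 c0d b bC.
have sub m : chart_box m -> closed_chart_box m.
  by move=> [im md]; split=> // k; exact: ltW.
apply: interval_induction.
- by move=> r _ /chart_box_nbhs; exact: cc.
- split => // k; apply: lt_le_trans (c0d k) _.
  have := le_lt_trans (normr_ge0 _) (c0d k); lra.
move=> r /andP[r0 rb] below.
(* [c r] is a limit of points [c q] with [q < r], known to be in the box; the [q] chosen below is
   nonnegative and within [e / 2] of [r]. *)
have Qr : closed_chart_box (c r).
  have /closure_id QE : closed (c @^-1` closed_chart_box).
    by apply: preimage_closed => // q _; exact: cc.
  suff : closure (c @^-1` closed_chart_box) r by rewrite -QE.
  move=> U /nbhs_ballP[e /= e0 eU].
  pose q := r - Num.min (r / 2) (e / 2).
  have m0 : 0 < Num.min (r / 2) (e / 2) by rewrite lt_min !divr_gt0.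
  have [mr me] : Num.min (r / 2) (e / 2) <= r / 2 /\ Num.min (r / 2) (e / 2) <= e / 2.
    by rewrite !ge_min !lexx orbT.
  exists q; split; first by apply/sub/below; rewrite /q; apply/andP; split; lra.
  by apply: eU; rewrite /ball /= /q subKr gtr0_norm //; lra.
have Qq q : 0 <= q <= r -> closed_chart_box (c q).
  by move=> /andP[q0]; rewrite le_eqVlt => /predU1P[->//|qr]; apply/sub/below; rewrite q0.
case: (Qr) => icr _; split => // k.
(* The displacement up to time [r] is at most [b * C < d / 2]; added to an initial offset below
   [d / 2], it leaves the curve in the open box. *)
have [|q] := @MVT_sym _ (fun q => chart i (c q) 0 k) (dc^~ k) 0 r.
  by move=> q; rewrite min_l ?max_r ?(ltW r0) // => /Qq /dcC /(_ k) [].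
rewrite min_l ?max_r ?(ltW r0) // => /Qq /dcC /(_ k) [_ dq].
rewrite subr0 => Er.
rewrite -(subrKA (chart i (c 0) 0 k)) (le_lt_trans (ler_normD _ _)) //.
rewrite Er normrM (gtr0_norm r0).
have : `|dc q k| * r <= b * C.
  by rewrite mulrC ler_pM // ltW.
have := c0d k; lra.
Qed.

End FlowContinuity.

Section FlowContinuityAtZero.
Context {R : realType} {M : topologicalType} {A : atlas R M}.
Hypotheses (hA : smooth_atlas A) (hM : hausdorff_space M).
Variables (K : field_rep A) (phi : R -> M -> M).
Hypothesis hphi : is_flow [set: R] (fun _ => K) phi.

Lemma flow_continuous z : continuous (phi^~ z).
Proof.
move=> r; have [_ /(_ r z I) v] := hphi.
by have [] := has_velocity_is_derive (@filterT _ (nbhs r) _) v.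
Qed.

Lemma flow_is_derive i z r k : dom i (phi r z) ->
  is_derive r (1 : R) (fun q => chart i (phi q z) 0 k) (K i (phi r z) 0 k).
Proof.
move=> iz; have [_ /(_ r z I) v] := hphi.
by have [_ /(_ i k iz)] := has_velocity_is_derive (@filterT _ (nbhs r) _) v.
Qed.

(** A bound on the speed near [y] gives all nearby starting points a common time during which they
    stay in a small box; this suffices for joint continuity at time 0. *)
Lemma flow_cvg (y : M) :
    (forall i k, {within dom i, continuous (component K i k)}) ->
  phi p.1 p.2 @[p --> ((0 : R), y)] --> y.
Proof.
move=> Kc O Oy; have [phi0 _] := hphi.
pose i := chart_at A y; pose x := chart i y.
have iy : dom i y by have [/(_ y)] := hA.
have ix : img i x by exact: img_chart.
(* The summand 1 leaves room for the variation of the components of [K] near [y]. *)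
pose C := 1 + \sum_k `|K i y 0 k|.
have C0 : 0 < C by rewrite ltr_pwDl // sumr_ge0.
have KC k : \forall m \near y, `|component K i k m| < C.
  move/cvgrPdist_lt: (within_dom_continuous hA iy (Kc i k)) => /(_ 1 ltr01).
  apply: filterS => m Km.
  have : `|K i y 0 k| <= \sum_k `|K i y 0 k|.
    by rewrite (bigD1 k) //= lerDl sumr_ge0.
  rewrite -(subrK (component K i k y) (component K i k m)).
  move: (ler_normD (component K i k m - component K i k y) (component K i k y)).
  by move: Km; rewrite distrC /C /component; lra.
have near_y : \forall m \near y, O m /\ forall k, `|component K i k m| < C.
  by apply: filterI => //; exact: filter_forall.
have := chart_inv_cvg hA ix; rewrite chartK // => /(_ _ near_y).
rewrite {1}/fmap /= {1}/within /= => /nbhs_ballP[d1 /= d10 Hd1].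
have [_ _ _ /(_ i)[U Uo iU] _] := hA.
have /nbhs_ballP[d2 /= d20 Hd2] : nbhs x U.
  by apply: open_nbhs_nbhs; split => //; move: ix; rewrite iU => -[].
pose d := Num.min d1 d2 / 2.
have m0 : 0 < Num.min d1 d2 by rewrite lt_min d10.
have d0 : 0 < d by rewrite divr_gt0.
have [dd1 dd2] : d < d1 /\ d < d2.
  have : Num.min d1 d2 <= d1 /\ Num.min d1 d2 <= d2 by rewrite !ge_min !lexx orbT.
  by rewrite /d => -[]; split; lra.
have inball (m : M) e : d < e -> (forall k, `|chart i m 0 k - x 0 k| <= d) ->
    ball x e (chart i m).
  move=> de md; apply/(rV_ballP _ _ (lt_trans d0 de)) => k.
  by rewrite distrC (le_lt_trans (md k)).
have boximg (q : 'rV[R]_3) : (forall k, `|q 0 k - x 0 k| <= d) -> model i q -> img i q.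
  move=> qx mq; rewrite iU; split => //; apply: Hd2.
  by apply/(rV_ballP _ _ d20) => k; rewrite distrC (le_lt_trans (qx k)).
have Qcl := closed_chart_box_closed hA hM boximg.
have QOK m : closed_chart_box i x d m ->
    O m /\ forall k, `|component K i k m| < C.
  move=> [im md]; rewrite -(chartK hA im); apply: Hd1; last exact: img_chart.
  exact: inball.
(* Speed [C] during time [b] costs [d / 4], less than the margin [d / 2] of the points that start in
   the half-size box. *)
pose b := d / 4 / C.
have b0 : 0 < b by rewrite !divr_gt0.
have bC : b * C < d / 2 by rewrite divfK ?gt_eqF //; lra.
suff stay r z : `|r| <= b -> chart_box i x (d / 2) z -> O (phi r z).
  have zn : nbhs y (chart_box i x (d / 2)).
    apply: chart_box_nbhs => //; split => // k.
    by rewrite subrr normr0 divr_gt0.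
  exists ([set r | `|r| <= b], chart_box i x (d / 2)); last first.
    by move=> [r z] [/= rb zb]; exact: stay.
  split => //=; have := @nbhs0_lt R R^o b b0.
  by apply: filterS => r /ltW.
move=> rb [iz zx].
have [r0|/ltW r0] := leP 0 r.
  have [|r' Qr' k||||ir rx] := @curve_stays_in_box _ _ _ hA i x d (phi^~ z)
    (fun r k => K i (phi r z) 0 k) C Qcl _ (ltW C0) _ _ _ b bC r.
  - exact: flow_continuous.
  - split; first by apply: flow_is_derive; case: Qr'.
    by have [_ /(_ k)/ltW] := QOK _ Qr'.
  - by rewrite phi0.
  - by rewrite phi0.
  - by rewrite r0 -(ger0_norm r0).
  - by case: (QOK (phi r z)) => //; split => // k; exact: ltW.
(* Negative times are handled by reversing the curve, whose velocity is then [- K]. *)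
have [|r' Qr' k||||ir rx] := @curve_stays_in_box _ _ _ hA i x d (fun r => phi (- r) z)
  (fun r k => - K i (phi (- r) z) 0 k) C Qcl _ (ltW C0) _ _ _ b bC (- r).
- move=> q; apply: (@continuous_comp R R M -%R (phi^~ z)).
    exact: opp_continuous.
  exact: flow_continuous.
- rewrite normrN; split; last by have [_ /(_ k)/ltW] := QOK _ Qr'.
  rewrite -mulrN1;
  apply: (@is_derive1_comp R (fun q => chart i (phi q z) 0 k) -%R r').
  by apply: flow_is_derive; case: Qr'.
- by rewrite oppr0 phi0.
- by rewrite oppr0 phi0.
- by rewrite oppr_ge0 r0 -(ler0_norm r0).
move: ir rx; rewrite opprK => ir rx.
by case: (QOK (phi r z)) => //; split => // k; exact: ltW.
Qed.

End FlowContinuityAtZero.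

(** * Commuting flows *)

Section PairConvergence.
Context {U V : topologicalType}.

Lemma cvg_pair_nbhs (I : Type) (F : set_system I) (f : I -> U) (g : I -> V)
    (a : U) (b : V) :
  Filter F -> f @ F --> a -> g @ F --> b ->
  (f x, g x) @[x --> F] --> (a, b).
Proof. by move=> FF fa gb; exact: (@cvg_pair _ _ _ F (nbhs a) (nbhs b)). Qed.

Lemma cvg_fst_nbhs (a : U) (b : V) : z.1 @[z --> (a, b)] --> a.
Proof. exact: (@cvg_fst _ _ (nbhs a) (nbhs b)). Qed.

Lemma cvg_snd_nbhs (a : U) (b : V) : z.2 @[z --> (a, b)] --> b.
Proof. exact: (@cvg_snd _ _ (nbhs a) (nbhs b)). Qed.

End PairConvergence.

Section CommutingFlows.
Context {R : realType} {M : topologicalType} {A : atlas R M}.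
Hypotheses (hA : smooth_atlas A) (hM : hausdorff_space M).
Variables (K : field_rep A) (phi : R -> M -> M).
Hypotheses (hK : smooth_field K) (hphi : is_flow [set: R] (fun _ => K) phi).
Variables (J : set R) (u : R -> field_rep A) (gamma : R -> M -> M).
Hypotheses (hu : C1_time_space J u) (hgamma : is_flow J u gamma).
Hypothesis hu1 :
  forall t, J t -> forall i k, Cn_on i (dom i) 1 (component (u t) i k).
Hypothesis hcomm :
  forall t, J t -> forall r m, gamma t (phi r m) = phi r (gamma t m).

Lemma smooth_field_C1 i k : Cn_on i (dom i) 1 (component K i k).
Proof. by case: hK => _; exact. Qed.

Lemma phi_cvg (y : M) : phi p.1 p.2 @[p --> ((0 : R), y)] --> y.
Proof.
apply: flow_cvg hphi _ _ => // i k.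
by have [+ _] := smooth_field_C1 i k; move=> /(_ [::] isT).
Qed.

Lemma time_space_cvg (g : R * M -> R) (i : chart_index A) t y :
    nbhs t J -> dom i y -> {within J `*` dom i, continuous g} ->
  g z @[z --> (t, y)] --> g (t, y).
Proof.
move=> Jt iy /subspace_continuousP /(_ (t, y)) gc.
have Jiy : nbhs (t, y) (J `*` dom i).
  by exists (J, dom i) => //; split => //; exact: dom_nbhs.
by move: gc; rewrite within_interior //; apply; exact: nbhs_singleton.
Qed.

Lemma gamma_is_derive i m t k : nbhs t J -> dom i (gamma t m) ->
  is_derive t (1 : R) (fun r => chart i (gamma r m) 0 k) (u t i (gamma t m) 0 k).
Proof.
move=> Jt im; have [_ /(_ t m (nbhs_singleton Jt)) v] := hgamma.
by have [_ /(_ i k im)] := has_velocity_is_derive Jt v.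
Qed.

Lemma gamma_cvg m t : nbhs t J -> gamma r m @[r --> t] --> gamma t m.
Proof.
move=> Jt; have [_ /(_ t m (nbhs_singleton Jt)) v] := hgamma.
by have [] := has_velocity_is_derive Jt v.
Qed.

(* In coordinates, [phi r (gamma s m) = gamma s (phi r m)] has [s]-derivative
   [u s] and [r]-derivative [K]; the bracket is the difference of its mixed
   second derivatives. *)
Lemma commuting_bracket i (t : R) m k : nbhs t J -> dom i (gamma t m) ->
  \sum_a K i (gamma t m) 0 a * pd i a (component (u t) i k) (gamma t m)
  = \sum_a u t i (gamma t m) 0 a * pd i a (component K i k) (gamma t m).
Proof.
move=> Jt iy; have [phi0 _] := hphi.
pose Z s r := phi r (gamma s m).
have Z0 s : Z s 0 = gamma s m by rewrite /Z phi0.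
have Zcvg : Z z.1 z.2 @[z --> (t, (0 : R))] --> gamma t m.
  have zc : (z.2, gamma z.1 m) @[z --> (t, (0 : R))] --> ((0 : R), gamma t m).
    have c1 : gamma z.1 m @[z --> (t, (0 : R))] --> gamma t m.
      exact: (@cvg_comp _ _ _ (fun z : R * R => z.1) (gamma^~ m) _ _ _
        (@cvg_fst_nbhs R R t 0) (@gamma_cvg m t Jt)).
    exact: cvg_pair_nbhs (@cvg_snd_nbhs R R t 0) c1.
  exact: (cvg_comp _ _ zc (@phi_cvg (gamma t m))).
have tZcvg : (z.1, Z z.1 z.2) @[z --> (t, (0 : R))] --> (t, gamma t m).
  exact: cvg_pair_nbhs (@cvg_fst_nbhs R R t 0) Zcvg.
have := @mixed_partials R (fun s r => chart i (Z s r) 0 k)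
  (fun s r => u s i (Z s r) 0 k) (fun s r => K i (Z s r) 0 k)
  (fun s r => \sum_a K i (Z s r) 0 a * pd i a (component (u s) i k) (Z s r))
  (fun s r => \sum_a u s i (Z s r) 0 a * pd i a (component K i k) (Z s r)) t 0.
rewrite !Z0; apply.
- have near1 : \forall z \near (t, (0 : R)), nbhs z.1 J.
    by have := @cvg_fst_nbhs R R t 0 => /(_ _ (nbhs_interior Jt)).
  have near2 : \forall z \near (t, (0 : R)), dom i (Z z.1 z.2).
    by apply: Zcvg; exact: dom_nbhs.
  apply: filterS2 near1 near2 => -[s r] /= Js iz.
  (* Commutation enters here: for fixed [r], [Z] is also the [gamma]-path of [phi r m], so its
     [s]-derivative is [u]. *)
  have ZE : \forall q \near s, gamma q (phi r m) = Z q r.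
    by apply: filterS Js => q Jq; exact: hcomm.
  have ZEs : gamma s (phi r m) = Z s r by exact: nbhs_singleton ZE.
  have dchart a : is_derive s (1 : R) (fun q => chart i (Z q r) 0 a) (u s i (Z s r) 0 a).
    have := @gamma_is_derive i (phi r m) s a Js; rewrite ZEs => /(_ iz).
    by apply: near_eq_is_derive; apply: filterS ZE => q ->.
  split => //.
  + exact: flow_is_derive.
  + apply: (is_derive_curve hA (c := Z s) iz).
    * exact: hu1 (nbhs_singleton Js) _ _.
    * exact: flow_continuous hphi _ _.
    * by move=> a; exact: flow_is_derive.
  + apply: (is_derive_curve hA (c := Z^~ r) iz) => //.
    * exact: smooth_field_C1.
    * rewrite -ZEs; apply: cvg_trans (@gamma_cvg (phi r m) s Js).
      by apply: near_eq_cvg.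
- have [_ _ _ _] := hu i k; apply: cvg_sumr => a _; apply: cvgM.
    exact: (cvg_comp _ _ Zcvg (within_dom_continuous hA iy
      ((smooth_field_C1 i a).1 [::] isT))).
  have [_ _ /(_ a) c _] := hu i k.
  exact: (cvg_comp _ _ tZcvg (time_space_cvg Jt iy c)).
- apply: cvg_sumr => a _; apply: cvgM.
    have [c _ _ _] := hu i a.
    exact: (cvg_comp _ _ tZcvg (time_space_cvg Jt iy c)).
  exact: (cvg_comp _ _ Zcvg (within_dom_continuous hA iy
      ((smooth_field_C1 i k).1 [:: a] isT))).
Qed.

End CommutingFlows.

(** * Derivatives of the swirl and of the pressure along the two flows *)

Section SwirlDerivatives.
Context {R : realType} {M : topologicalType} {A : atlas R M}.
Hypotheses (hA : smooth_atlas A) (hM : hausdorff_space M) (hR : riemannian A).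

(** Pulls the inverse metric out of the Christoffel term of the acceleration, ready for lowering the
    index. *)
Lemma christoffel_quadratic (g u : 'I_3 -> R) (D : 'I_3 -> 'I_3 -> 'I_3 -> R) :
  \sum_a u a * \sum_b (2^-1 * \sum_c g c * D a b c) * u b
  = \sum_c g c * (2^-1 * \sum_a \sum_b D a b c * u a * u b).
Proof. by rewrite !big_ord_recl !big_ord0; ring. Qed.

Lemma form_sum (v w : 'rV[R]_3) (g : 'M[R]_3) :
  (v *m g *m w^T) 0 0 = \sum_a \sum_b v 0 a * g a b * w 0 b.
Proof.
rewrite mxE exchange_big; apply: eq_bigr => b _.
by rewrite !mxE mulr_suml; apply: eq_bigr => a _.
Qed.

(** The Jacobians in the components are absorbed by those in the metric. A fixed chart is needed for
    differentiating, whereas [inner] picks a chart at each point, possibly jumping along a curve. *)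
Lemma innerE i m (v w : field_rep A) : vector_field v -> vector_field w ->
    dom i m ->
  inner v w m = \sum_a \sum_b v i m 0 a * metric i m a b * w i m 0 b.
Proof.
move=> vv ww im; rewrite -form_sum /inner; set j := chart_at A m.
have jm : dom j m by have [/(_ m)] := hA.
have [_ _ _ gT] := hR.
rewrite (vv i j m im jm) (ww i j m im jm) (gT i j m im jm).
by rewrite trmx_mul !mulmxA.
Qed.

Lemma metric_sym (i : chart_index A) m a b : dom i m -> metric i m a b = metric i m b a.
Proof. by move=> im; have [_ /(_ i m im) {1}<- _ _] := hR; rewrite mxE. Qed.

(** A nonzero vector in the kernel would have length 0, against positive definiteness. *)
Lemma metric_unit (i : chart_index A) m : dom i m -> metric i m \in unitmx.
Proof.
move=> im; rewrite -row_free_unit -kermx_eq0; apply/negPn/negP => k0.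
have /rowV0Pn[v vk v0] := k0.
have [_ _ /(_ i m v im v0) + _] := hR.
by move/sub_kermxP: vk => ->; rewrite mul0mx mxE ltxx.
Qed.

Lemma pd_metric_sym (i : chart_index A) m c a b : dom i m ->
  pd i c (fun m' => metric i m' a b) m = pd i c (fun m' => metric i m' b a) m.
Proof.
by move=> im; apply: (pd_congr hA) => // m' im'; exact: metric_sym.
Qed.

Lemma metric_C1 (i : chart_index A) a b : Cn_on i (dom i) 1 (fun m => metric i m a b).
Proof. by have [+ _ _ _] := hR; apply. Qed.

Variables (K : field_rep A) (phi : R -> M -> M).
Hypotheses (hK : killing K) (hphi : is_flow [set: R] (fun _ => K) phi).
Variables (J : set R) (u : R -> field_rep A) (gamma : R -> M -> M).
Hypotheses (hu : C1_time_space J u) (hgamma : is_flow J u gamma).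
Hypothesis huv : forall t, J t -> vector_field (u t).
Hypothesis hu1 :
  forall t, J t -> forall i k, Cn_on i (dom i) 1 (component (u t) i k).
Hypothesis hcomm :
  forall t, J t -> forall r m, gamma t (phi r m) = phi r (gamma t m).
Hypothesis hsurj : forall t, J t -> forall y, exists m, gamma t m = y.

Let hKs : smooth_field K := hK.1.
Let hKv : vector_field K := hKs.1.

(** Commutation gives the identity at points [gamma t m], and [gamma t] is onto. *)
Lemma bracket_eq0 i t y k : nbhs t J -> dom i y ->
  \sum_a K i y 0 a * pd i a (component (u t) i k) y
  = \sum_a u t i y 0 a * pd i a (component K i k) y.
Proof.
move=> Jt; have [m <-] := hsurj (nbhs_singleton Jt) y.
exact: (commuting_bracket hA hM hKs hphi hu hgamma hu1 hcomm).
Qed.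

Lemma is_derive_along_phi i f r y : dom i (phi r y) -> Cn_on i (dom i) 1 f ->
  is_derive r (1 : R) (fun q => f (phi q y))
    (\sum_c K i (phi r y) 0 c * pd i c f (phi r y)).
Proof.
move=> iy fC1; apply: (is_derive_curve hA (c := phi^~ y) iy fC1).
  exact: (flow_continuous hphi).
by move=> k; exact: (flow_is_derive hphi).
Qed.

Lemma is_derive_along_gamma i f t m : nbhs t J -> dom i (gamma t m) ->
    Cn_on i (dom i) 1 f ->
  is_derive t (1 : R) (fun q => f (gamma q m))
    (\sum_c u t i (gamma t m) 0 c * pd i c f (gamma t m)).
Proof.
move=> Jt iy fC1; apply: (is_derive_curve hA (c := gamma^~ m) iy fC1).
  exact: (gamma_cvg hgamma Jt).
by move=> k; exact: (gamma_is_derive hgamma).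
Qed.

Lemma is_derive_swirl_along_phi t r y : nbhs t J ->
  is_derive r (1 : R) (fun q => swirl K (u t) (phi q y)) 0.
Proof.
move=> Jt; have Jt' := nbhs_singleton Jt; pose z := phi r y.
pose i := chart_at A z; have iz : dom i z by have [/(_ z)] := hA.
have near_i : \forall q \near r, dom i (phi q y).
  have phic : phi q y @[q --> r] --> z by exact: (flow_continuous hphi).
  by apply: phic; exact: dom_nbhs.
have := is_derive_bilinear
  (fun a => is_derive_along_phi (y := y) iz (hu1 Jt' i a))
  (fun a b => is_derive_along_phi (y := y) iz (metric_C1 i a b))
  (fun b => is_derive_along_phi (y := y) iz (smooth_field_C1 hKs i b)).
rewrite (swirl_orbit_algebra _ (fun k => bracket_eq0 k Jt iz)); last first.
  by move=> a b; have [_ ] := hK; exact.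
apply: near_eq_is_derive; apply: filterS near_i => q iq.
by rewrite /swirl (innerE (huv Jt') hKv iq).
Qed.

Lemma swirl_phi t r y : nbhs t J ->
  swirl K (u t) (phi r y) = swirl K (u t) y.
Proof.
move=> Jt; have [phi0 _] := hphi.
have := @is_derive_0_is_cst R (fun q => swirl K (u t) (phi q y)) r 0
  (fun q => is_derive_swirl_along_phi q y Jt).
by rewrite phi0.
Qed.

(** The material derivative in components: [is_derive_diagonal] with time as first variable and the
    position on the path as second. *)
Lemma is_derive_u_gamma i t m k : nbhs t J -> dom i (gamma t m) ->
  is_derive t (1 : R) (fun q => u q i (gamma q m) 0 k)
    (derive_within J (fun q => u q i (gamma t m) 0 k) t 1
     + \sum_c u t i (gamma t m) 0 c
         * pd i c (component (u t) i k) (gamma t m)).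
Proof.
move=> Jt iy.
have gc := gamma_cvg hgamma (m := m) Jt.
apply: (is_derive_diagonal (H := fun s r => u s i (gamma r m) 0 k)
  (Hs := fun s r => derive_within J (fun q => u q i (gamma r m) 0 k) s 1)).
- have near1 : \forall z \near (t, t), nbhs z.1 J.
    by have := @cvg_fst_nbhs R R t t => /(_ _ (nbhs_interior Jt)).
  have near2 : \forall z \near (t, t), dom i (gamma z.2 m).
    by have := @cvg_snd_nbhs R R t t => /(_ _ (gc _ (dom_nbhs hA iy))).
  apply: filterS2 near1 near2 => -[s r] /= Js iz.
  have [_ _ _ /(_ s _ (nbhs_singleton Js) iz) du] := hu i k.
  exact: is_derive_within.
- have zc : (z.1, gamma z.2 m) @[z --> (t, t)] --> (t, gamma t m).
    have c1 : gamma z.2 m @[z --> (t, t)] --> gamma t m.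
      exact: (@cvg_comp _ _ _ (fun z : R * R => z.2) (gamma^~ m) _ _ _
        (@cvg_snd_nbhs R R t t) gc).
    exact: cvg_pair_nbhs (@cvg_fst_nbhs R R t t) c1.
  have [_ c _ _] := hu i k.
  exact: (cvg_comp _ _ zc (time_space_cvg hA Jt iy c)).
- exact: (is_derive_along_gamma Jt iy (hu1 (nbhs_singleton Jt) i k)).
Qed.

Variable p : R -> M -> R.
Hypothesis euler : forall t, J t -> forall i m k, dom i m ->
  derive_within J (fun r : R => u r i m 0 k) t 1
    + nabla (u t) (u t) i m 0 k = - gradient (p t) i m 0 k.

(** Multiplying the Euler equations by the metric cancels the inverse metric in both the gradient
    and the Christoffel symbols, which is the form used in [swirl_flow_algebra]. *)
Lemma euler_lowered t i y l : J t -> dom i y ->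
  \sum_k metric i y l k *
      (derive_within J (fun q => u q i y 0 k) t 1
       + \sum_c u t i y 0 c * pd i c (component (u t) i k) y)
  = - (pd i l (p t) y + 2^-1 * \sum_a \sum_b
        (pd i a (fun m' => metric i m' b l) y
         + pd i b (fun m' => metric i m' a l) y
         - pd i l (fun m' => metric i m' a b) y) * u t i y 0 a * u t i y 0 b).
Proof.
move=> Jt iy.
pose Y : 'cV[R]_3 := \col_c (pd i c (p t) y + 2^-1 * \sum_a \sum_b
        (pd i a (fun m' => metric i m' b c) y
         + pd i b (fun m' => metric i m' a c) y
         - pd i c (fun m' => metric i m' a b) y) * u t i y 0 a * u t i y 0 b).
pose X : 'cV[R]_3 := \col_k (derive_within J (fun q => u q i y 0 k) t 1
       + \sum_c u t i y 0 c * pd i c (component (u t) i k) y).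
have XY : X = - (invmx (metric i y) *m Y).
  apply/colP => k; have := euler Jt k iy; rewrite !mxE.
  under eq_bigr => a _ do rewrite mulrDr.
  rewrite big_split /= => E.
  under [in RHS]eq_bigr => c _ do rewrite mxE mulrDr.
  rewrite [in RHS]big_split /= -christoffel_quadratic.
  by move: E; rewrite /christoffel; lra.
have : metric i y *m X = - Y.
  by rewrite XY mulmxN mulmxA mulmxV ?mul1mx // metric_unit.
by move/colP => /(_ l); rewrite !mxE => <-; apply: eq_bigr => k _; rewrite mxE.
Qed.

Lemma is_derive_swirl_along_gamma (i : chart_index A) (t : R) m :
    nbhs t J -> dom i (gamma t m) ->
  is_derive t (1 : R) (fun q => swirl K (u q) (gamma q m))
    (- \sum_c K i (gamma t m) 0 c * pd i c (p t) (gamma t m)).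
Proof.
move=> Jt iy; have Jt' := nbhs_singleton Jt.
have near_i : \forall q \near t, J q /\ dom i (gamma q m).
  apply: filterI => //; have gc := gamma_cvg hgamma (m := m) Jt.
  by apply: gc; exact: dom_nbhs.
have := is_derive_bilinear
  (fun a => is_derive_u_gamma a Jt iy)
  (fun a b => is_derive_along_gamma Jt iy (metric_C1 i a b))
  (fun b => is_derive_along_gamma Jt iy (smooth_field_C1 hKs i b)).
rewrite (swirl_flow_algebra _ _ _ (fun l => euler_lowered l Jt' iy)); last first.
- by move=> c a b; exact: pd_metric_sym.
- by move=> a b; exact: metric_sym.
- by move=> a b; have [_ ] := hK; exact.
apply: near_eq_is_derive; apply: filterS near_i => q [Jq iq].
by rewrite /swirl (innerE (huv Jq) hKv iq).
Qed.

Definition along_K (f : M -> R) y :=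
  let i := chart_at A y in \sum_c K i y 0 c * pd i c f y.

Lemma dom_chart_at (y : M) : dom (chart_at A y) y.
Proof. by have [/(_ y)] := hA. Qed.

(* The swirl is constant on the orbits of [K], hence so is its material
   derivative [- K p]. *)
Lemma pressure_rate_phi t r y : nbhs t J ->
  along_K (p t) (phi r y) = along_K (p t) y.
Proof.
move=> Jt; have Jt' := nbhs_singleton Jt; have [m <-] := hsurj Jt' y.
have near_eq : \forall q \near t,
    swirl K (u q) (gamma q (phi r m)) = swirl K (u q) (gamma q m).
  apply: filterS (nbhs_interior Jt) => q Jq.
  by rewrite hcomm ?swirl_phi //; exact: nbhs_singleton Jq.
have [_ d1] := is_derive_swirl_along_gamma Jt (dom_chart_at (gamma t (phi r m))).
have [_ d2] := is_derive_swirl_along_gamma Jt (dom_chart_at (gamma t m)).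
apply: oppr_inj; rewrite -hcomm // /along_K -d1 -d2.
exact: near_eq_derive.
Qed.

Hypothesis hp : forall t, J t -> forall i : chart_index A, Cn_on i (dom i) 1 (p t).

(** The derivative of the difference of the two sides in [r] is K p at [phi r y] minus K p at [y],
    which is 0 by [pressure_rate_phi]. *)
Lemma pressure_phi t r y : nbhs t J ->
  p t (phi r y) = p t y + r * along_K (p t) y.
Proof.
move=> Jt; have Jt' := nbhs_singleton Jt; have [phi0 _] := hphi.
have dp q : is_derive q (1 : R) (fun q => p t (phi q y) - q * along_K (p t) y) 0.
  have d1 := is_derive_along_phi (dom_chart_at (phi q y)) (hp Jt' _).
  have d2 := is_deriveM (is_derive_id q (1 : R))
    (is_derive_cst (along_K (p t) y) q (1 : R)).
  apply: (is_derive_eq (is_deriveB d1 d2)).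
  rewrite -(pressure_rate_phi q y Jt) /along_K /GRing.scale /= mulr0 add0r mulr1.
  by rewrite subrr.
have := @is_derive_0_is_cst R _ r 0 dp; rewrite phi0 mul0r subr0 => <-.
by rewrite subrK.
Qed.

(** Covers the end points of [J], where the derivative of the swirl has not been computed. *)
Lemma swirl_gamma_cvg q m : J q ->
  swirl K (u r) (gamma r m) @[r --> within J (nbhs q)]
    --> swirl K (u q) (gamma q m).
Proof.
move=> Jq; have [_ /(_ q m Jq) [gc _]] := hgamma.
pose i := chart_at A (gamma q m); have iy := dom_chart_at (gamma q m).
have near_i : \forall r \near within J (nbhs q), J r /\ dom i (gamma r m).
  by apply: filterI; [exact: withinT|apply: gc; exact: dom_nbhs].
rewrite /swirl (innerE (huv Jq) hKv iy).
have zc : (r, gamma r m) @[r --> within J (nbhs q)]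
    --> within (J `*` dom i) (nbhs (q, gamma q m)).
  apply: cvg_into_within => //; apply: cvg_pair_nbhs => //.
  exact: cvg_within.
have lim : \sum_a \sum_b u r i (gamma r m) 0 a * metric i (gamma r m) a b
      * K i (gamma r m) 0 b @[r --> within J (nbhs q)]
    --> \sum_a \sum_b u q i (gamma q m) 0 a * metric i (gamma q m) a b
      * K i (gamma q m) 0 b.
  apply: cvg_sumr => a _; apply: cvg_sumr => b _; apply: cvgM; first apply: cvgM.
  - have [/subspace_continuousP uc _ _ _] := hu i a.
    exact: (cvg_comp _ _ zc (uc (q, gamma q m) (conj Jq iy))).
  - have gcont := within_dom_continuous hA iy ((metric_C1 i a b).1 [::] isT).
    exact: (cvg_comp _ _ gc gcont).
  - have Kcont := within_dom_continuous hA iy ((smooth_field_C1 hKs i b).1 [::] isT).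
    exact: (cvg_comp _ _ gc Kcont).
apply: cvg_trans lim; apply: near_eq_cvg.
apply: filterS near_i => r [Jr ir].
by rewrite (innerE (huv Jr) hKv ir).
Qed.

Hypothesis hJ : is_interval J.

(** Mean value theorem on the segment from [a] to [b]: its interior points are interior to [J], so
    the derivative there is - K p = 0, and continuity within [J] suffices at the ends. *)
Lemma swirl_transported a b m : J a -> J b -> a <= b ->
    (forall t, nbhs t J -> forall y, along_K (p t) y = 0) ->
  swirl K (u b) (gamma b m) = swirl K (u a) (gamma a m).
Proof.
move=> Ja Jb ab Kp0.
have abJ q : a <= q <= b -> J q by exact: hJ.
have [||c _] := @MVT_segment R (fun q => swirl K (u q) (gamma q m)) (fun=> 0) a b ab.
- move=> q; rewrite in_itv /= => qab.
  have Jq : nbhs q J.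
    have : nbhs q `]a, b[%classic by apply: near_in_itvoo; rewrite in_itv.
    by apply: filterS => q'; rewrite /= in_itv /= => /andP[? ?]; apply: abJ; rewrite !ltW.
  have := is_derive_swirl_along_gamma Jq (dom_chart_at (gamma q m)).
  by rewrite [X in - X](Kp0 q Jq) oppr0.
- apply/subspace_continuousP => q; rewrite /= in_itv /= => /abJ Jq.
  apply: (cvg_trans _ (@swirl_gamma_cvg q m Jq)).
  apply: (cvg_app (fun r => swirl K (u r) (gamma r m))).
  by apply: within_subset => q'; rewrite /= in_itv /=; exact: abJ.
by rewrite mul0r => /eqP; rewrite subr_eq0 => /eqP.
Qed.

End SwirlDerivatives.

(** * Square integrable fields on Euclidean space *)

Section SquareIntegrable.
Context {R : realType}.

(** The sets decrease to the empty set because the reals are archimedean; continuity from above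
    applies as [E] has finite measure. *)
Lemma measure_tail_cvg0 d (T : measurableType d) (mu : {measure set T -> \bar R})
    (E : set T) (h : T -> R) :
    measurable E -> (mu E < +oo)%E -> measurable_fun setT h ->
  mu (E `&` [set x | n%:R <= h x]) @[n --> \oo] --> 0%E.
Proof.
move=> mE Efin mh.
have mF n : measurable (E `&` [set x | n%:R <= h x]).
  apply: measurableI => //; rewrite -[X in measurable X]setTI.
  exact: measurable_fun_le.
have F0 : \bigcap_n (E `&` [set x | n%:R <= h x]) = set0.
  rewrite -subset0 => x xF; have [_ /=] := xF (Num.truncn (h x)).+1 I.
  by rewrite leNgt truncnS_gt.
rewrite -(measure0 mu) -F0; apply: nonincreasing_cvg_mu => //.
- by apply: le_lt_trans Efin; apply: le_measure; rewrite ?inE.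
- by rewrite F0; exact: measurable0.
move=> n m nm; apply/subsetPset => x [Ex /= mx]; split => //=.
by apply: le_trans mx; rewrite ler_nat.
Qed.

(** Markov's inequality. *)
Lemma measure_superlevel_fin d (T : measurableType d)
    (mu : {measure set T -> \bar R}) (f : T -> R) (e : R) : 0 < e ->
    measurable_fun setT f -> (forall x, 0 <= f x) ->
    (\int[mu]_x (f x)%:E < +oo)%E ->
  (mu [set x | (e <= f x)%R] < +oo)%E.
Proof.
move=> e0 mf f0 ffin; set E := [set x | e <= f x].
have mE : measurable E.
  by rewrite -[X in measurable X]setTI; exact: measurable_fun_le.
have /measurable_EFinP mEf := mf.
have : (e%:E * mu E < +oo)%E.
  rewrite -integral_cst //; apply: le_lt_trans ffin.
  apply: (@le_trans _ _ (\int[mu]_(x in E) (f x)%:E)%E).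
    apply: ge0_le_integral => //.
    - by move=> x _; rewrite lee_fin ltW.
    - exact: measurable_funS mEf.
  by apply: ge0_subset_integral => // x _; rewrite lee_fin.
have := measure_ge0 mu E; case: (mu E) => [r _ _|_|//]; first exact: ltry.
by rewrite gt0_muley ?lte_fin.
Qed.

Lemma lebesgue3_box (a1 a2 a3 eta : R) : 0 < eta ->
  lebesgue3 (`]a1 - eta, a1 + eta[ `*` `]a2 - eta, a2 + eta[
             `*` `]a3 - eta, a3 + eta[)
  = ((2 * eta) ^+ 3)%:E.
Proof.
move=> eta0.
have E3 (X : set (R * R)) (Y : set R) : measurable X -> measurable Y ->
    lebesgue3 (X `*` Y)
    = ((lebesgue_measure \x lebesgue_measure) X * lebesgue_measure Y)%E.
  by move=> mX mY; exact: product_measure1E.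
have E2 (X Y : set R) : measurable X -> measurable Y ->
    (lebesgue_measure \x lebesgue_measure)%E (X `*` Y)
    = (lebesgue_measure X * lebesgue_measure Y)%E.
  by move=> mX mY; exact: product_measure1E.
rewrite E3 //; last exact: measurableX.
rewrite E2 //.
have len (a : R) : lebesgue_measure `]a - eta, a + eta[%classic = (2 * eta)%:E.
  rewrite lebesgue_measure_itv /= lte_fin ifT; last lra.
  by rewrite -EFinB; congr _%:E; lra.
by rewrite !len -!EFinM !exprS expr0 mulr1 mulrA.
Qed.

(** The set where the sum of squares is at least [e] has finite measure, so its part far from the
    origin has measure below the volume of a box of half-side [eta]; yet it contains such boxes
    arbitrarily far away. *)
Lemma square_integrable_vanishes_far (f : 'I_3 -> 'rV[R]_3 -> R) (e eta : R) :
    0 < e -> 0 < eta -> (forall k, square_integrable setT (f k)) ->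
    (forall B : R, exists a : 'rV[R]_3, B <= \sum_j `|a 0 j| /\
      forall x : 'rV[R]_3, (forall j, `|x 0 j - a 0 j| < eta) ->
        e <= \sum_k f k x ^+ 2) ->
  False.
Proof.
move=> e0 eta0 fL2 far.
pose mu := lebesgue3 (R:=R) : {measure set _ -> \bar R}.
pose g z := \sum_k f k (vec3 z) ^+ 2.
pose h z := \sum_j `|(vec3 z : 'rV[R]_3) 0 j|.
have mf k : measurable_fun setT (f k \o @vec3 R) by have [] := fL2 k.
have mg : measurable_fun setT g.
  by apply: measurable_sum => k; exact: (measurable_funX 2 (mf k)).
have mh : measurable_fun setT h.
  apply: measurable_sum => j; apply: measurableT_comp => //.
  case: j => -[|[|[|//]]] ?; under eq_fun do rewrite mxE /=.
  - apply: (measurableT_comp measurable_fst); exact: measurable_fst.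
  - apply: (measurableT_comp measurable_snd); exact: measurable_fst.
  - exact: measurable_snd.
have g0 z : 0 <= g z by apply: sumr_ge0 => k _; exact: sqr_ge0.
have gfin : (\int[mu]_z (g z)%:E < +oo)%E.
  under eq_integral do rewrite -sumEFin.
  rewrite ge0_integral_sum //.
  - by apply: lte_sum_pinfty => k _; have [_] := fL2 k.
  - by move=> k; apply/measurable_EFinP; exact: (measurable_funX 2 (mf k)).
  - by move=> k z _; rewrite lee_fin sqr_ge0.
have Efin : (mu [set z | (e <= g z)%R] < +oo)%E.
  exact: (@measure_superlevel_fin _ _ mu g e e0 mg g0 gfin).
have mE : measurable [set z | e <= g z].
  by rewrite -[X in measurable X]setTI; exact: measurable_fun_le.
have := @measure_tail_cvg0 _ _ mu _ h mE Efin mh.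
have v0 : 0 < (2 * eta) ^+ 3 by rewrite exprn_gt0 // mulr_gt0.
move=> /fine_cvgP[mufin /cvgrPdist_lt /(_ _ v0) mulim].
have [n _ /(_ n (leqnn n)) /= [nfin]] := filterI mufin mulim.
rewrite sub0r normrN ger0_norm ?fine_ge0 // -lte_fin fineK //.
rewrite ltNge => /negP; apply.
(* A point of the box differs from its centre by at most [3 * eta] in the sum of absolute
   coordinates. *)
have [a [aB ae]] := far (n%:R + 3 * eta).
rewrite -(lebesgue3_box (a 0 0) (a 0 1) (a 0 2) eta0).
apply: le_measure; rewrite ?inE.
- by apply: measurableX => //; exact: measurableX.
- apply: measurableI => //; rewrite -[X in measurable X]setTI.
  exact: measurable_fun_le.
move=> z [/= [z1 z2] z3].
have za j : `|(vec3 z : 'rV[R]_3) 0 j - a 0 j| < eta.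
  move: z1 z2 z3; rewrite !in_itv /= -!ltr_distl => z1 z2 z3.
  case: j => -[|[|[|//]]] ?; rewrite mxE /=.
  - by rewrite (_ : Ordinal _ = 0) //; exact: val_inj.
  - by rewrite (_ : Ordinal _ = 1) //; exact: val_inj.
  - by rewrite (_ : Ordinal _ = 2) //; exact: val_inj.
split => /=; first exact: ae.
have : \sum_j `|a 0 j| <= \sum_j (`|(vec3 z : 'rV[R]_3) 0 j| + eta).
  apply: ler_sum => j _; have := ltW (za j).
  have := ler_normB (vec3 z 0 j : R) (vec3 z 0 j - a 0 j).
  rewrite opprB addrC subrK; lra.
rewrite big_split /= sumr_const card_ord -mulr_natl /h; lra.
Qed.

End SquareIntegrable.

(** * Killing flows and commuting fields on Euclidean space *)

Section Euclidean.
Context {R : realType} {M : topologicalType} {A : atlas R M}.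
Hypothesis hA : smooth_atlas A.
Variable i : chart_index A.
Hypotheses (domT : dom i = setT) (imgT : img i = setT) (bdryF : ~~ bdry i).
Hypothesis metric1 : forall m, metric i m = 1%:M.

Lemma domI m : dom i m. Proof. by rewrite domT. Qed.

Lemma imgI x : img i x. Proof. by rewrite imgT. Qed.

Lemma quotient_within_cst k (a : R) m :
  quotient_within (img i) (cst a \o chart_inv i) (chart i m) (basis_vec R k) --> 0.
Proof.
have near_img : \forall h \near (0 : R), img i (h *: basis_vec R k + chart i m).
  by near=> h; exact: imgI.
have -> := quotient_withinE (cst a \o chart_inv i) near_img.
rewrite (_ : (fun h => _) = cst 0); first exact: (@cvg_cst _ (0 : R)).
by apply/funext => h; rewrite /= subrr scaler0.
Unshelve. all: by end_near. Qed.

Lemma pd_cst k (a : R) m : pd i k (cst a) m = 0.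
Proof.
have near_img : \forall h \near (0 : R), img i (h *: basis_vec R k + chart i m).
  by near=> h; exact: imgI.
have := @quotient_within_cst k a m; rewrite /pd /derive_within.
have -> := quotient_withinE (cst a \o chart_inv i) near_img.
exact: cvg_lim.
Unshelve. all: by end_near. Qed.

Lemma pds_cst (a : R) l : exists b, pds i l (cst a) = cst b.
Proof.
elim: l => [|k l [b IH]] /=; first by exists a.
by exists 0; rewrite IH; apply/funext => m; rewrite pd_cst.
Qed.

Lemma cutoff1 : cutoff i (dom i) (cst 1).
Proof.
split; last by rewrite domT.
- move=> n; split.
    by move=> l _; have [b ->] := pds_cst 1 l => x; exact: cvg_cst.
  move=> l k m _ _; have [b ->] := pds_cst 1 l.
  by apply/cvg_ex; exists 0; exact: quotient_within_cst.
- move=> l; have [b ->] := pds_cst 1 l.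
  by exists `|b| => m _.
Qed.

(** With cutoff 1 localization returns the component itself, and the empty multi-index in [sobolev]
    says that it is in L^2. *)
Lemma sobolev_field_square_integrable s v k : sobolev_field s v ->
  square_integrable setT (component v i k \o chart_inv i).
Proof.
move=> [_ _ /(_ i k _ cutoff1) [D [D0 /(_ [::] isT) [+ _] _]]].
rewrite D0; have -> : model_interior i = setT.
  by rewrite /model_interior (negbTE bdryF); apply/seteqP.
congr square_integrable; apply/funext => x; rewrite /localize.
by rewrite asboolT ?mul1r //; exact: imgI.
Qed.

Lemma chart_inv_continuous : continuous (chart_inv i).
Proof.
move=> x; have := chart_inv_cvg hA (imgI x).
by rewrite within_interior // imgT; exact: filterT.
Qed.

Lemma compact_chart_box (B : R) :
  compact (chart_inv i @` [set x : 'rV[R]_3 | forall k, `[- B, B]%classic (x 0 k)]).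
Proof.
apply: continuous_compact.
  by apply: continuous_subspaceT; exact: chart_inv_continuous.
apply: (@rV_compact R 3 (fun=> `[- B, B]%classic)) => k.
exact: segment_compact.
Qed.

Variables (K : field_rep A) (phi : R -> M -> M).
Hypotheses (hK : killing K) (hphi : is_flow [set: R] (fun _ => K) phi).

(** The metric coefficients are constant, so only the derivatives of [K] survive in the Killing
    equation. *)
Lemma killing_antisym m a b :
  pd i a (component K i b) m + pd i b (component K i a) m = 0.
Proof.
have [_ /(_ i m a b (domI m))] := hK.
have pd0 c : pd i c (fun m' => metric i m' a b) m = 0.
  rewrite -(pd_cst c ((1%:M : 'M[R]_3) a b) m); congr (pd i c _ m).
  by apply/funext => m'; rewrite metric1.
under eq_bigr => c _ do rewrite pd0 mulr0 add0r !metric1 !mxE.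
rewrite big_split /= (bigD1 b) //= eqxx mul1r big1 ?addr0; last first.
  by move=> c /negbTE ->; rewrite mul0r.
rewrite (bigD1 a) //= eqxx mul1r big1 ?addr0 //.
by move=> c; rewrite eq_sym => /negbTE ->; rewrite mul0r.
Qed.

Lemma antisym_form (v : 'I_3 -> R) m :
  \sum_k v k * \sum_a v a * pd i a (component K i k) m = 0.
Proof.
set S := \sum_k _; suff SN : S = - S by move: SN; lra.
rewrite {1}/S; under eq_bigr do rewrite mulr_sumr.
rewrite exchange_big -sumrN; apply: eq_bigr => k _.
rewrite mulr_sumr -sumrN; apply: eq_bigr => a _.
have /eqP := killing_antisym m a k; rewrite addr_eq0 => /eqP ->.
by ring.
Qed.

(** On the segment from [z] to [x] with direction v, the function <v, K> has derivative <v, DK v>,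
    which is 0 as DK is antisymmetric. *)
Lemma killing_orthogonal x z :
  \sum_k (chart i x 0 k - chart i z 0 k) * (K i x 0 k - K i z 0 k) = 0.
Proof.
pose v := chart i x - chart i z; pose c (r : R) := chart_inv i (r *: v + chart i z).
have chartc r : chart i (c r) = r *: v + chart i z.
  by rewrite (chart_invK hA) //; exact: imgI.
have c0 : c 0 = z by rewrite /c scale0r add0r (chartK hA) //; exact: domI.
have c1 : c 1 = x by rewrite /c scale1r subrK (chartK hA) //; exact: domI.
have cc : continuous c.
  move=> r; have lin : (q *: v + chart i z) @[q --> r] --> r *: v + chart i z.
    by apply: cvgD; [apply: cvgZr_tmp; exact: cvg_id|exact: cvg_cst].
  exact: (cvg_comp _ _ lin (@chart_inv_continuous _)).
have dc r k : is_derive r (1 : R) (fun q => chart i (c q) 0 k) (v 0 k).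
  under eq_fun do rewrite chartc mxE mxE.
  have D := is_deriveD
    (is_deriveM (is_derive_id r (1 : R)) (is_derive_cst (v 0 k) r (1 : R)))
    (is_derive_cst (chart i z 0 k) r (1 : R)).
  by apply: (is_derive_eq D); rewrite /GRing.scale /= mulr0 mulr1 add0r addr0.
have dpsi r : is_derive r (1 : R) (fun q => \sum_k v 0 k * K i (c q) 0 k) 0.
  apply: (is_derive_eq _ (antisym_form (v 0) (c r))); apply: is_derive_sumE => k.
  have dK := is_derive_curve hA (domI (c r)) (smooth_field_C1 hK.1 i k) (cc r) (dc r).
  have D := is_deriveM (is_derive_cst (v 0 k) r (1 : R)) dK.
  by apply: (is_derive_eq D); rewrite /GRing.scale /= mulr0 addr0.
have := @is_derive_0_is_cst R _ 1 0 dpsi; rewrite c0 c1 => /eqP.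
rewrite -subr_eq0 -sumrB => /eqP E; rewrite -[RHS]E; apply: eq_bigr => k _.
by rewrite -mulrBr !mxE.
Qed.

(** The squared distance has derivative 2 <a - b, K(a) - K(b)> = 0. Arbitrary integral curves are
    allowed, so that uniqueness follows as well. *)
Lemma integral_curves_isometric (a b : R -> M) :
    (forall r k, is_derive r (1 : R) (fun q => chart i (a q) 0 k) (K i (a r) 0 k)) ->
    (forall r k, is_derive r (1 : R) (fun q => chart i (b q) 0 k) (K i (b r) 0 k)) ->
  forall r, norm2 (chart i (a r) - chart i (b r))
            = norm2 (chart i (a 0) - chart i (b 0)).
Proof.
move=> da db r; apply: (@is_derive_0_is_cst R
  (fun r => norm2 (chart i (a r) - chart i (b r)))) => {}r.
have -> : (fun r => norm2 (chart i (a r) - chart i (b r)))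
    = (fun r => \sum_k (chart i (a r) 0 k - chart i (b r) 0 k) ^+ 2).
  by apply/funext => q; apply: eq_bigr => k _; rewrite !mxE.
have sum0 : \sum_k 2 * ((chart i (a r) 0 k - chart i (b r) 0 k)
    * (K i (a r) 0 k - K i (b r) 0 k)) = 0.
  by rewrite -mulr_sumr killing_orthogonal mulr0.
apply: (is_derive_eq _ sum0); apply: is_derive_sumE => k.
have dk : is_derive r (1 : R) (fun q => chart i (a q) 0 k - chart i (b q) 0 k)
    (K i (a r) 0 k - K i (b r) 0 k) by exact: is_deriveB.
by apply: (is_derive_eq (is_deriveM dk dk)); rewrite /GRing.scale /=; ring.
Qed.

Lemma phi_isometric r y z :
  norm2 (chart i (phi r y) - chart i (phi r z)) = norm2 (chart i y - chart i z).
Proof.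
have [phi0 _] := hphi.
have dphi m q k : is_derive q (1 : R) (fun q => chart i (phi q m) 0 k)
    (K i (phi q m) 0 k) by exact: flow_is_derive hphi _ _ _ _ (domI _).
have := integral_curves_isometric (dphi y) (dphi z) r.
by rewrite phi0.
Qed.

Lemma norm2_ge (x : 'rV[R]_3) k : x 0 k ^+ 2 <= norm2 x.
Proof. by rewrite /norm2 (bigD1 k) //= lerDl sumr_ge0 // => *; exact: sqr_ge0. Qed.

(** The flow is given without a group law. Both [phi q (phi r y)] and [phi (q + r) y] are integral
    curves in [q] with the same start, so they coincide; take [q = - r]. *)
Lemma phiNK r y : phi (- r) (phi r y) = y.
Proof.
have [phi0 _] := hphi.
have dshift q k : is_derive q (1 : R) (fun q' => chart i (phi (q' + r) y) 0 k)
    (K i (phi (q + r) y) 0 k).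
  have d1 := flow_is_derive hphi k (domI (phi (q + r) y)).
  have d2 := is_deriveD (is_derive_id q (1 : R)) (is_derive_cst r q (1 : R)).
  apply: (is_derive_eq (@is_derive1_comp R (fun q => chart i (phi q y) 0 k)
    (fun q' => q' + r) q _ _ d1 d2)).
  by rewrite addr0 mulr1.
have := @integral_curves_isometric (phi^~ (phi r y)) (fun q => phi (q + r) y)
  (fun q k => flow_is_derive hphi k (domI _)) dshift (- r).
rewrite /= addNr add0r phi0 /= subrr => n0.
rewrite -[LHS](chartK hA (domI _)) -[RHS](chartK hA (domI _)); congr chart_inv.
apply/rowP => k; apply/eqP; rewrite -subr_eq0 -sqrf_eq0 eq_le sqr_ge0 andbT.
have := norm2_ge (chart i (phi (- r) (phi r y)) - chart i y) k; rewrite n0 !mxE.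
by rewrite /norm2 big1 // => j _; rewrite mxE expr0n.
Qed.

Variable v : field_rep A.
Hypothesis v1 : forall k, Cn_on i (dom i) 1 (component v i k).
Hypothesis bracket0 : forall y k,
  \sum_a K i y 0 a * pd i a (component v i k) y
  = \sum_a v i y 0 a * pd i a (component K i k) y.

(** As [v] and [K] commute, the derivative of |v|^2 along the orbit is 2 <v, DK v> = 0. *)
Lemma speed_phi r y : norm2 (v i (phi r y)) = norm2 (v i y).
Proof.
have [phi0 _] := hphi; rewrite -{2}[y]/(id y) -phi0.
apply: (@is_derive_0_is_cst R (fun r => norm2 (v i (phi r y)))) => {}r.
have sum0 : \sum_k 2 * (v i (phi r y) 0 k * \sum_a v i (phi r y) 0 a
    * pd i a (component K i k) (phi r y)) = 0.
  by rewrite -mulr_sumr antisym_form mulr0.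
apply: (is_derive_eq _ sum0); apply: is_derive_sumE => k; rewrite -bracket0.
have dk : is_derive r (1 : R) (fun q => v i (phi q y) 0 k)
    (\sum_a K i (phi r y) 0 a * pd i a (component v i k) (phi r y)).
  exact: (is_derive_curve hA (c := phi^~ y) (domI (phi r y)) (v1 k)
    (@flow_continuous _ _ _ _ _ hphi y r)
    (fun k => flow_is_derive hphi k (domI (phi r y)))).
by apply: (is_derive_eq (is_deriveM dk dk)); rewrite /GRing.scale /=; ring.
Qed.

Hypothesis vL2 : forall k, square_integrable setT (component v i k \o chart_inv i).

(* The speed is constant on the orbits of the isometric flow [phi]: near a
   point where [v] does not vanish, it is bounded below on copies of the same
   ball going to infinity. *)
Lemma unbounded_orbit_field0 y0 :
    (forall B : R, exists r, B <= \sum_j `|chart i (phi r y0) 0 j|) ->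
  forall z, v i z = 0.
Proof.
move=> unb z; apply: contrapT => vz0.
have w0 : 0 < norm2 (v i z).
  rewrite lt_neqAle sumr_ge0 ?andbT; last by move=> k _; exact: sqr_ge0.
  apply/eqP => n0; apply: vz0; apply/rowP => k; rewrite mxE.
  apply/eqP; rewrite -sqrf_eq0 eq_le sqr_ge0 andbT.
  by have := norm2_ge (v i z) k; rewrite -n0.
have cont : norm2 (v i (chart_inv i x)) @[x --> chart i z] --> norm2 (v i z).
  have ck k : component v i k (chart_inv i x) @[x --> chart i z]
      --> component v i k z.
    rewrite -{2}(chartK hA (domI z)).
    exact: (cvg_comp _ _ (@chart_inv_continuous (chart i z))
      (within_dom_continuous hA (domI _) ((v1 k).1 [::] isT))).
  have sq : \sum_k component v i k (chart_inv i x) * component v i k (chart_inv i x)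
      @[x --> chart i z] --> \sum_k component v i k z * component v i k z.
    apply: (@cvg_sumr R _ _ (nbhs (chart i z)) _ _ _ _ _) => k _.
    exact: cvgM (ck k) (ck k).
  exact: sq.
have w2 : 0 < norm2 (v i z) / 2 by rewrite divr_gt0.
move/cvgrPdist_lt: cont => /(_ _ w2) /nbhs_ballP[d /= d0 dv].
(* A box of half-side [d / 2] lies in the Euclidean ball of radius [d], since
   [3 * (d / 2) ^+ 2 < d ^+ 2]; Euclidean distance is what [phi] preserves. *)
have eta0 : 0 < d / 2 by rewrite divr_gt0.
apply: (@square_integrable_vanishes_far R (fun k => component v i k \o chart_inv i)
  _ _ w2 eta0 vL2) => B.
(* The orbits of [y0] and [z] stay at constant distance; by |t| <= 1 + t^2, passing from one to the
   other costs at most the term in parentheses for each of three coordinates. *)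
have [r rB] := unb (B + 3 * (1 + norm2 (chart i y0 - chart i z))).
exists (chart i (phi r z)); split.
  apply: (@le_trans _ _ (\sum_j `|chart i (phi r y0) 0 j|
      - 3 * (1 + norm2 (chart i y0 - chart i z)))); first by lra.
  rewrite -[X in X * (1 + _)](_ : (\sum_(j < 3) 1 = 3 :> R)); last first.
    by rewrite sumr_const card_ord.
  rewrite mulr_suml -sumrB; apply: ler_sum => j _; rewrite mul1r.
  have := norm2_ge (chart i (phi r y0) - chart i (phi r z)) j.
  rewrite phi_isometric !mxE.
  move: (chart i (phi r y0) 0 j) (chart i (phi r z) 0 j) => p q pq.
  have := ler_normD (p - q) q; rewrite subrK => tri.
  have : `|p - q| <= 1 + (p - q) ^+ 2.
    rewrite -[(p - q) ^+ 2]real_normK ?num_real //.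
    have := sqr_ge0 (`|p - q| - 1); rewrite sqrrB1; have := normr_ge0 (p - q).
    lra.
  lra.
move=> x xbox.
suff : norm2 (v i z) / 2 <= norm2 (v i (phi (- r) (chart_inv i x))).
  by rewrite speed_phi.
(* The point [x] near [phi r z] is carried back by [phi (- r)] to a point near [z], where the lower
   bound on the speed is known. *)
have dist : norm2 (chart i (phi (- r) (chart_inv i x)) - chart i z) < d ^+ 2.
  rewrite -{1}(phiNK r z) phi_isometric (chart_invK hA (imgI x)) /norm2.
  apply: (@le_lt_trans _ _ (\sum_(k < 3) (d / 2) ^+ 2)).
    apply: ler_sum => k _; rewrite !mxE -[X in X <= _]real_normK ?num_real //.
    by rewrite lerXn2r ?nnegrE ?(ltW eta0) //; exact: ltW.
  rewrite sumr_const card_ord -mulr_natl exprMn.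
  have : 0 < d ^+ 2 by rewrite exprn_gt0.
  lra.
have : ball (chart i z) d (chart i (phi (- r) (chart_inv i x))).
  apply/(rV_ballP _ _ d0) => k; rewrite -(@ltr_pXn2r _ 2) ?nnegrE ?(ltW d0) //.
  rewrite real_normK ?num_real // -sqrrN opprB.
  by have := norm2_ge (chart i (phi (- r) (chart_inv i x)) - chart i z) k;
    rewrite !mxE => /le_lt_trans; exact.
move=> /dv /=; rewrite (chartK hA (domI _)) ltr_norml => /andP[_].
lra.
Qed.

End Euclidean.

(** * Vanishing of K p and conservation of the swirl *)

Lemma affine_bounded_above (R : realType) (a c B : R) :
  (forall r, a + r * c <= B) -> c = 0.
Proof.
move=> acB; apply: contrapT => /eqP c0.
(* This choice of [r] gives the value [B + 1]. *)
by have := acB ((B - a + 1) / c); rewrite divfK //; lra.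
Qed.

Theorem theorem3p5 (R : realType) (M : topologicalType) (A : atlas R M)
    (K : field_rep A) (phi : R -> M -> M) (s : R) (J : set R)
    (u0 : field_rep A) (u : R -> field_rep A) (gamma : R -> M -> M)
    (hM : connected_oriented_riemannian_manifold A)
    (hMc : compact [set: M] \/ euclidean_R3 A)
    (hK : killing K) (hKt : tangent_to_boundary K)
    (hphi : is_flow [set: R] (fun _ => K) phi)
    (hs : 5 / 2 < s)
    (hJ : is_interval J) (hJ0 : J 0)
    (hu0 : axisymmetric_field K s u0)
    (hu : euler_solution s J u0 u)
    (hgamma : axisymmetric_geodesic phi s J u gamma) :
  forall t, J t -> swirl K (u t) \o gamma t = swirl K u0.
Proof.
have [hH _ hA _ hR] := hM.
have [uS uC uu0 [p hp]] := hu; have [gflow gdiff] := hgamma.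
have uV t : J t -> vector_field (u t) by case/uS => -[].
have u1 t : J t -> forall i k, Cn_on i (dom i) 1 (component (u t) i k).
  by case/uS => -[].
have gcomm t : J t -> forall r m, gamma t (phi r m) = phi r (gamma t m).
  by case/gdiff => _ _ + r m; exact.
have gsurj t : J t -> forall y, exists m, gamma t m = y.
  by case/gdiff => -[_ [zeta [_ gK _]]] _ _ y; exists (zeta y).
have p1 t : J t -> forall i : chart_index A, Cn_on i (dom i) 1 (p t).
  by case/hp.
have euler t : J t -> forall i m k, dom i m ->
    derive_within J (fun r => u r i m 0 k) t 1 + nabla (u t) (u t) i m 0 k
    = - gradient (p t) i m 0 k.
  by case/hp.
have pc t : J t -> continuous (p t).
  move=> Jt y; have iy := dom_chart_at hA y.
  exact: (within_dom_continuous hA iy ((p1 t Jt _).1 [::] isT)).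
have p_affine t r y := pressure_phi hA hH hR hK hphi uC gflow uV u1 gcomm gsurj
  euler p1 (t := t) r y.
(* On a compact set containing the orbit the pressure has a maximum, while it is affine along the
   orbit with slope K p. *)
have bounded_orbit t y (C : set M) : nbhs t J -> compact C ->
    (forall r, C (phi r y)) -> along_K K (p t) y = 0.
  move=> Jt cC Cphi; have [||c _ cmax] := @compact_EVT_max M R (p t) C _ cC.
  - by exists (phi 0 y).
  - by apply: continuous_subspaceT; exact: (pc t (nbhs_singleton Jt)).
  apply: (@affine_bounded_above R (p t y) _ (p t c)) => r.
  by rewrite -p_affine //; apply: cmax; rewrite inE.
have Kp0 t : nbhs t J -> forall y, along_K K (p t) y = 0.
  move=> Jt y; case: hMc => [cM|[i [iE domT bdryF imgT metric1]]].
    exact: (bounded_orbit t y _ Jt cM (fun=> I)).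
  apply: contrapT => c0.
  have unb (B : R) : exists r, B <= \sum_j `|chart i (phi r y) 0 j|.
    apply: contrapT => /forallNP bnd; apply: c0.
    apply: (bounded_orbit t y _ Jt (compact_chart_box hA imgT (B := B))) => r.
    exists (chart i (phi r y)); last by rewrite (chartK hA) // domT.
    move=> k; rewrite /= in_itv /= -ler_norml.
    have /negP := bnd r; rewrite -ltNge => /ltW; apply: le_trans.
    by rewrite (bigD1 k) //= lerDl sumr_ge0.
  (* Unboundedness concerns the orbit of [phi] alone, so the field vanishes at all interior times
     [q], not only at [t]; this allows differentiating the swirl in time at [t]. *)
  have uz0 q z : nbhs q J -> u q i z = 0.
    move=> Jq; have Jq' := nbhs_singleton Jq.
    apply: (unbounded_orbit_field0 hA domT imgT metric1 hK hphi (u1 q Jq' i) _ _ unb).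
      move=> y' k; apply: (bracket_eq0 hA hH hK hphi uC gflow u1 gcomm gsurj) => //.
      by rewrite domT.
    move=> k; have [us _ _] := uS q Jq'.
    exact: (sobolev_field_square_integrable domT imgT bdryF k us).
  have Jt' := nbhs_singleton Jt; have [m my] := gsurj t Jt' y.
  have := is_derive_swirl_along_gamma hA hR hK uC gflow uV u1 euler Jt
    (dom_chart_at hA (gamma t m)).
  rewrite my => -[_ dswirl]; apply: c0; apply: oppr_inj; rewrite oppr0 /along_K.
  rewrite -dswirl -[RHS](derive_cst (0 : R) t (1 : R)); apply: near_eq_derive.
  apply: filterS (nbhs_interior Jt) => q Jq.
  rewrite /swirl /inner (iE (chart_at _ _)) uz0 // mul0mx mul0mx mxE //.
move=> t Jt; apply/funext => m /=.
have [gam0 _] := gflow.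
have -> : swirl K u0 m = swirl K (u 0) (gamma 0 m).
  by rewrite gam0 /swirl /inner uu0 //; exact: dom_chart_at.
(* [J] may contain negative times, for which the transport runs from [t] to 0. *)
have [t0|/ltW t0] := leP 0 t.
  exact: (swirl_transported hA hR hK uC gflow uV u1 euler hJ).
by apply/esym; exact: (swirl_transported hA hR hK uC gflow uV u1 euler hJ).
Qed.
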